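(* Let $\Gamma\subset\mathbb{C}$ be a Jordan curve with arc-length parametrization $\gamma\in C^2$, and let $\beta\ge1$. Then the parametrization process $X^x$ is a diffusion process in the sense of Kolmogorov with identity diffusion matrix and drift coefficient $b=\frac12\nabla\log\rho_{\beta,N}$. That is, for all $\delta>0$, $x\in D$, $z\in \mathbb{R}^N$ such that $\overline{B(x,\delta)}\subset D$: (1) $\lim_{h\to0+}\frac1h\int_{B(x,\delta)^c}p(x,h,y)\,dy=0$; (2) $\lim_{h\to0+}\frac1h\int_{B(x,\delta)}(y-x)\,p(x,h,y)\,dy=b(x)$; (3) $\lim_{h\to0+}\frac1h\int_{B(x,\delta)}((y-x)\cdot z)^2\,p(x,h,y)\,dy=|z|^2$.
   Context: $\Gamma$ has length $l$; $\gamma:\mathbb{R}\to\Gamma$ is its $l$-periodic (counterclockwise) arc-length parametrization. $N$ is a fixed positive integer. $D=\{x\in\mathbb{R}^N:x_1<x_2<\dots<x_N<x_1+l\}$. The density $\rho_{\beta,N}$ is a positive constant multiple of $\prod_{1\le i\ne j\le N}|\gamma(x_i)-\gamma(x_j)|^{\beta/2}$, so $b=\frac12\nabla\log\rho_{\beta,N}$ has components $b_i(x)=\frac{\beta}{2}\sum_{j\ne i}\mathrm{Re}\frac{\gamma'(x_i)}{\gamma(x_i)-\gamma(x_j)}$. For $\beta\ge1$ the parametrization process $X^x$ started at $x\in D$ is the unique strong solution of $dX(t)=dB(t)+b(X(t))dt$, $X(0)=x$, with $B$ an $N$-dimensional standard Brownian motion; it stays in $D$ for all times almost surely, and its transition probability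 function $P(x,t,dy)=\mathbb{P}[X^x(t)\in dy]$ has a density $p(x,t,y)$ with respect to Lebesgue measure on $D$ for every $t>0$. $B(x,\delta)$ is the open ball of radius $\delta$ about $x$ and $B(x,\delta)^c$ its complement in $D$. *)

(* Defs.v *)
From HB Require Import structures.
From mathcomp Require Import all_boot all_order all_algebra.
From mathcomp Require Import all_classical all_reals all_analysis.
From mathcomp Require Export complex.
Set Implicit Arguments.
Unset Strict Implicit.
Unset Printing Implicit Defensive.
Import Order.TTheory GRing.Theory Num.Theory.
Import numFieldNormedType.Exports.
Local Open Scope classical_set_scope.
Local Open Scope ring_scope.

Definition measure_rV_display : measure_display -> measure_display.
Proof. exact. Qed.

Section measurable_rV.
Context {d} {T : measurableType d}.
Variable n : nat.

Let coors : 'I_n -> 'rV[T]_n -> T := fun i x => x ord0 i.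

Let rV_set0 : g_sigma_preimage coors set0.
Proof. exact: sigma_algebra0. Qed.

Let rV_setC A : g_sigma_preimage coors A -> g_sigma_preimage coors (~` A).
Proof. exact: sigma_algebraC. Qed.

Let rV_bigcup (F : _^nat) : (forall i, g_sigma_preimage coors (F i)) ->
  g_sigma_preimage coors (\bigcup_i (F i)).
Proof. exact: sigma_algebra_bigcup. Qed.

(* The product sigma-algebra, generated by the coordinates. Over [R] with its
   Borel sigma-algebra this is the Borel sigma-algebra of [R^n]. *)
HB.instance Definition _ := @isMeasurable.Build (measure_rV_display d)
  'rV[T]_n (g_sigma_preimage coors) rV_set0 rV_setC rV_bigcup.

End measurable_rV.

Lemma measurable_coord d (T : measurableType d) n (i : 'I_n) :
  measurable_fun [set: 'rV[T]_n] (fun x : 'rV[T]_n => x ord0 i).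
Proof.
move=> _ Y mY; rewrite setTI; apply: sub_sigma_algebra => /=.
rewrite -bigcup_seq/=; exists i => /=; first by rewrite mem_index_enum.
by exists Y => //; rewrite setTI.
Qed.

Lemma measurable_fun_rVP d d' (T : measurableType d) (T' : measurableType d')
    n (f : T' -> 'rV[T]_n) :
  (forall i, measurable_fun setT (fun w => f w ord0 i)) ->
  measurable_fun setT f.
Proof.
move=> mf.
pose C := [set B : set 'rV[T]_n | measurable (f @^-1` B)].
suff sub : @measurable _ 'rV[T]_n `<=` C by move=> _ A mA; rewrite setTI; exact: sub.
apply: smallest_sub.
  split; rewrite /C /=.
  - by rewrite preimage_set0.
  - by move=> B mB; rewrite setTD preimage_setC; exact: measurableC.
  - by move=> F mF; rewrite preimage_bigcup; exact: bigcup_measurable.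
move=> A; rewrite -bigcup_seq => -[i _ [B mB <-]].
by rewrite /C /= setTI; have := mf i measurableT B mB; rewrite setTI.
Qed.

Section lebesgue_rV.
Context {R : realType}.

Definition cons_rV n (p : measurableTypeR R * 'rV[R]_n) : 'rV[R]_n.+1 :=
  row_mx (p.1 : R)%:M p.2.

Lemma cons_rV0 n p : @cons_rV n p ord0 ord0 = p.1.
Proof.
have -> : (ord0 : 'I_n.+1) = lshift n (ord0 : 'I_1) by exact/val_inj.
by rewrite /cons_rV (@row_mxEl R 1 1 n) mxE.
Qed.

Lemma cons_rVS n p j : @cons_rV n p ord0 (lift ord0 j) = p.2 ord0 j.
Proof.
have -> : lift (ord0 : 'I_n.+1) j = rshift 1 j by exact/val_inj.
by rewrite /cons_rV (@row_mxEr R 1 1 n).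
Qed.

Lemma measurable_cons_rV n : measurable_fun setT (@cons_rV n).
Proof.
apply: measurable_fun_rVP => i; have [j ->|->] := unliftP ord0 i.
  rewrite (_ : (fun _ => _) = (fun x : 'rV[R]_n => x ord0 j) \o snd).
    by apply: measurableT_comp; [exact: measurable_coord|exact: measurable_snd].
  by apply/funext => p; rewrite cons_rVS.
rewrite (_ : (fun _ => _) = fst); first exact: measurable_fst.
by apply/funext => p; rewrite cons_rV0.
Qed.

Section step.
Variables (n : nat) (mu : {sigma_finite_measure set 'rV[R]_n -> \bar R}).

Definition lebesgue_rV_step : set 'rV[R]_n.+1 -> \bar R :=
  pushforward (@lebesgue_measure R \x mu)%E (@cons_rV n).

Let step0 : lebesgue_rV_step set0 = 0%E.
Proof. by rewrite /lebesgue_rV_step /pushforward preimage_set0 measure0. Qed.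

Let step_ge0 A : (0 <= lebesgue_rV_step A)%E.
Proof. by rewrite /lebesgue_rV_step /pushforward measure_ge0. Qed.

Let step_sigma_additive : semi_sigma_additive lebesgue_rV_step.
Proof.
move=> F mF tF mUF; rewrite /lebesgue_rV_step /pushforward preimage_bigcup.
have mp A : measurable A -> measurable (@cons_rV n @^-1` A).
  by move=> mA; rewrite -[X in measurable X]setTI; exact: measurable_cons_rV.
apply: measure_semi_sigma_additive.
- by move=> k; exact: mp.
- apply/trivIsetP => /= i j _ _ ij; rewrite -preimage_setI.
  by move/trivIsetP : tF => /(_ _ _ _ _ ij) ->//; rewrite preimage_set0.
- by rewrite -preimage_bigcup; exact: mp.
Qed.

HB.instance Definition _ := isMeasure.Build _ _ _ lebesgue_rV_step
  step0 step_ge0 step_sigma_additive.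

Let step_sigma_finite : sigma_finite setT lebesgue_rV_step.
Proof.
pose f (x : 'rV[R]_n.+1) : measurableTypeR R * 'rV[R]_n :=
  (x ord0 ord0, \row_j x ord0 (lift ord0 j)).
have mf : measurable_fun setT f.
  apply: measurable_fun_pair; first exact: measurable_coord.
  apply: measurable_fun_rVP => i.
  rewrite (_ : (fun _ => _) = (fun x : 'rV[R]_n.+1 => x ord0 (lift ord0 i))).
    exact: measurable_coord.
  by apply/funext => x; rewrite mxE.
have fK p : f (@cons_rV n p) = p.
  case: p => a v; rewrite /f cons_rV0; congr pair.
  by apply/rowP => j; rewrite mxE cons_rVS.
have /sigma_finiteP[F [TF ndF Foo]] := sigma_finiteT (@lebesgue_measure R).
have /sigma_finiteP[G [TG ndG Goo]] := sigma_finiteT mu.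
exists (fun k => f @^-1` (F k `*` G k)).
  apply/seteqP; split => // x _.
  have : (\bigcup_k F k) (f x).1 by rewrite -TF.
  have : (\bigcup_k G k) (f x).2 by rewrite -TG.
  move=> [k _ Gk] [j _ Fj]; exists (maxn j k) => //; split.
    by move: Fj; exact/subsetPset/ndF/leq_maxl.
  by move: Gk; exact/subsetPset/ndG/leq_maxr.
move=> k; have [mF Fk] := Foo k; have [mG Gk] := Goo k; split.
  by rewrite -[X in measurable X]setTI; apply: mf => //; exact: measurableX.
rewrite /lebesgue_rV_step /pushforward.
rewrite [X in product_measure1 _ _ X](_ : _ = F k `*` G k); last first.
  by rewrite -comp_preimage (_ : f \o _ = id) ?preimage_id//; exact/funext.
by rewrite product_measure1E// lte_mul_pinfty// ge0_fin_numE.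
Qed.

HB.instance Definition _ := Measure_isSigmaFinite.Build _ _ _ lebesgue_rV_step
  step_sigma_finite.

End step.

Fixpoint lebesgue_rV n : {sigma_finite_measure set 'rV[R]_n -> \bar R} :=
  match n with
  | 0%N => \d_(0 : 'rV[R]_0)
  | m.+1 => lebesgue_rV_step (lebesgue_rV m)
  end.

Lemma lebesgue_rV_box n (A : 'I_n -> set R) :
  (forall i, measurable (A i)) ->
  lebesgue_rV n [set x : 'rV[R]_n | forall i, A i (x ord0 i)] =
  (\prod_(i < n) @lebesgue_measure R (A i))%E.
Proof.
elim: n A => [|n IH] A mA.
  rewrite big_ord0 /= diracE mem_set//=.
  by case.
rewrite big_ord_recl -(IH (fun j => A (lift ord0 j)))//.
rewrite /= /lebesgue_rV_step /pushforward -product_measure1E//; last first.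
  rewrite [X in measurable X](_ : _ = \bigcap_(i in [set: 'I_n])
      ((fun x : 'rV[R]_n => x ord0 i) @^-1` A (lift ord0 i))); last first.
    by apply/seteqP; split => x /= Ax i; [move=> _|]; exact: Ax.
  apply: fin_bigcap_measurable => // i _.
  by rewrite -[X in measurable X]setTI; exact: measurable_coord.
  exact: mA.
apply: congr1; apply/seteqP; split => -[a v] /=.
  move=> Av; split; first by have := Av ord0; rewrite cons_rV0.
  by move=> j; have := Av (lift ord0 j); rewrite cons_rVS.
move=> [Aa Av] i; have [j ->|->] := unliftP ord0 i.
  by rewrite cons_rVS; exact: Av.
by rewrite cons_rV0.
Qed.

End lebesgue_rV.

(* The library norm on ['rV[R]_n] is the max norm. *)
Section euclidean.
Context {R : realType} {n : nat}.

Definition dotp (x y : 'rV[R]_n) : R := \sum_(i < n) x ord0 i * y ord0 i.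

Definition enorm (x : 'rV[R]_n) : R := Num.sqrt (dotp x x).

Definition eball (x : 'rV[R]_n) (r : R) : set 'rV[R]_n :=
  [set y | enorm (y - x) < r].

End euclidean.

Section curve.
Context {R : realType}.

Definition derivC (g : R -> R[i]) (t : R) : R[i] :=
  (derive1 (fun s => complex.Re (g s)) t +i*
   derive1 (fun s => complex.Im (g s)) t)%C.

Definition C2_fun (f : R -> R) : Prop :=
  [/\ forall t, derivable f t 1, forall t, derivable (derive1 f) t 1
    & continuous (derive1 (derive1 f))].

Definition intC (a b : R) (g : R -> R[i]) : R[i] :=
  (\int[lebesgue_measure]_(t in `[a, b]) complex.Re (g t) +i*
   \int[lebesgue_measure]_(t in `[a, b]) complex.Im (g t))%C.

Definition winding (g : R -> R[i]) (l : R) (z : R[i]) : R[i] :=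
  (0 +i* (2 * pi))%C^-1 * intC 0 l (fun t => derivC g t / (g t - z)).

(* The points of the bounded component of the complement; the topology of the
   complex plane is carried by [R[i]^o]. *)
Definition jordan_interior (Gamma : set R[i]) : set R[i] :=
  [set z | ~ Gamma z /\ exists M : R,
     forall w : R[i]^o, connected_component (~` Gamma : set R[i]^o) z w ->
       Normc.normc w <= M].

(* Periodicity, continuity and injectivity on a period make [Gamma] the image of
   the circle [R / l Z] under a continuous injection, i.e. a Jordan curve; its
   length is [l] because of the unit speed. *)
Record jordan_arclength (Gamma : set R[i]) (l : R) (gamma : R -> R[i]) : Prop :=
  JordanArclength {
    ja_length_gt0 : 0 < l;
    ja_periodic : forall t, gamma (t + l) = gamma t;
    ja_injective : forall s t, 0 <= s < l -> 0 <= t < l ->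
      gamma s = gamma t -> s = t;
    ja_range : range gamma = Gamma;
    ja_C2 : C2_fun (fun t => complex.Re (gamma t)) /\
            C2_fun (fun t => complex.Im (gamma t));
    ja_unit_speed : forall t, Normc.normc (derivC gamma t) = 1;
    ja_counterclockwise : forall z, jordan_interior Gamma z ->
      winding gamma l z = 1
  }.

End curve.

Section coulomb_gas.
Context {R : realType} {N : nat}.

(* x_0 < x_1 < ... < x_(N-1) < x_0 + l *)
Definition chamber (l : R) : set 'rV[R]_N :=
  [set x | (forall i j : 'I_N, (i < j)%N -> x ord0 i < x ord0 j) /\
           (forall i j : 'I_N, i = 0%N :> nat -> j = N.-1 :> nat ->
              x ord0 j < x ord0 i + l)].

Definition rho (c beta : R) (gamma : R -> R[i]) (x : 'rV[R]_N) : R :=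
  c * \prod_(i < N) \prod_(j < N | j != i)
        Normc.normc (gamma (x ord0 i) - gamma (x ord0 j)) `^ (beta / 2).

Definition grad (f : 'rV[R]_N -> R) (x : 'rV[R]_N) : 'rV[R]_N :=
  \row_(i < N) 'D_(delta_mx ord0 i) f x.

Definition drift (c beta : R) (gamma : R -> R[i]) (x : 'rV[R]_N) : 'rV[R]_N :=
  2^-1 *: grad (fun y => ln (rho c beta gamma y)) x.

End coulomb_gas.

(* Processes are indexed by [R]; only times t >= 0 matter. *)
Section processes.
Context d (Omega : measurableType d) {R : realType} (P : probability Omega R).

(* As some of the A i may be the full line, this contains the product rule for
   subfamilies. *)
Definition independent_family (I : finType) (Y : I -> Omega -> R) : Prop :=
  forall A : I -> set R, (forall i, measurable (A i)) ->
    P [set w | forall i, A i (Y i w)] = (\prod_(i : I) P (Y i @^-1` A i))%E.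

Definition continuous_paths (N : nat) (X : R -> Omega -> 'rV[R]_N) : Prop :=
  {ae P, forall w, {within `[0, +oo[%classic, continuous (fun t => X t w)}}.

(* [normal_prob m s] has mean m and standard deviation s. *)
Record brownian_motion (N : nat) (B : R -> Omega -> 'rV[R]_N) : Prop :=
  BrownianMotion {
    bm_measurable : forall t, 0 <= t -> measurable_fun setT (B t);
    bm_start : {ae P, forall w, B 0 w = 0};
    bm_continuous : continuous_paths B;
    bm_gaussian : forall (i : 'I_N) s t, 0 <= s < t ->
      forall A : set R, measurable A ->
        P [set w | A (B t w ord0 i - B s w ord0 i)] =
        normal_prob 0 (Num.sqrt (t - s)) A;
    bm_independent : forall (n : nat) (t : nat -> R),
      0 <= t 0%N -> (forall k, t k <= t k.+1) ->
      independent_family (fun (ki : 'I_n * 'I_N) w =>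
        B (t ki.1.+1) w ord0 ki.2 - B (t ki.1) w ord0 ki.2)
  }.

(* [negligible] includes the non-measurable subsets of P-null sets. *)
Definition augmented_filtration (N : nat) (B : R -> Omega -> 'rV[R]_N) (t : R) :
    set (set Omega) :=
  <<s [set A | exists s (U : set 'rV[R]_N),
         [/\ 0 <= s <= t, measurable U & A = B s @^-1` U]] `|`
      P.-negligible >>.

(* X is a strong solution of dX = dB + b(X) dt, X(0) = x, staying in D.  As the
   noise is additive, the stochastic integral of dB is B itself. *)
Record strong_solution (N : nat) (D : set 'rV[R]_N)
    (b : 'rV[R]_N -> 'rV[R]_N) (B : R -> Omega -> 'rV[R]_N) (x : 'rV[R]_N)
    (X : R -> Omega -> 'rV[R]_N) : Prop :=
  StrongSolution {
    sol_measurable : forall t, 0 <= t -> measurable_fun setT (X t);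
    sol_adapted : forall t, 0 <= t -> forall U : set 'rV[R]_N, measurable U ->
      augmented_filtration B t (X t @^-1` U);
    sol_continuous : continuous_paths X;
    sol_in : {ae P, forall w, forall t, 0 <= t -> D (X t w)};
    sol_integrable : {ae P, forall w, forall t, 0 <= t -> forall i : 'I_N,
      lebesgue_measure.-integrable `[0, t]
        (fun s => (b (X s w) ord0 i)%:E)};
    sol_equation : {ae P, forall w, forall t, 0 <= t ->
      X t w = x + B t w +
        \row_(i < N) \int[lebesgue_measure]_(s in `[0, t]) b (X s w) ord0 i}
  }.

(* [p x t] is any version on D of the density of P[X^x(t) \in dy]. *)
Definition transition_density (N : nat) (D : set 'rV[R]_N)
    (X : 'rV[R]_N -> R -> Omega -> 'rV[R]_N)
    (p : 'rV[R]_N -> R -> 'rV[R]_N -> R) : Prop :=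
  forall x t, D x -> 0 < t ->
    [/\ measurable_fun D (p x t), forall y, D y -> 0 <= p x t y
      & forall A : set 'rV[R]_N, measurable A -> A `<=` D ->
          P (X x t @^-1` A) = (\int[lebesgue_rV N]_(y in A) (p x t y)%:E)%E].

End processes.

(* Main.v *)
(* Drive the process by B itself: on the event that the Brownian path stays
   small on [0, h], the equation X = x + B + int b(X) keeps X in a small ball
   around x (a first-exit argument), where b is close to b(x), so that
   X(h) - x = B(h) + h b(x) + o(h) pointwise. The complementary event has
   probability O(h^2): by dyadic chaining and path continuity it is contained in
   a countable union of events on single Gaussian increments, each controlled by
   its fourth moment, so neither a maximal inequality nor stochastic integration
   is needed. Integrating the pointwise expansion against E[B_i] = 0,
   E[B_i B_j] = h delta_ij and E[B_i^4] = O(h^2) yields the three limits. The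
   drift is continuous because the density is an explicit product that does not
   vanish on D. *)
Require Import Defs.
From HB Require Import structures.
From mathcomp Require Import all_boot all_order all_algebra.
From mathcomp Require Import all_classical all_reals all_analysis.
From mathcomp Require Import measurable_realfun.
From mathcomp Require Import ring lra.
Import Order.TTheory GRing.Theory Num.Theory.
Import numFieldNormedType.Exports.
Import HBNNSimple.
Local Open Scope classical_set_scope.
Local Open Scope ring_scope.
Set Implicit Arguments.
Unset Strict Implicit.

(** * Gaussian moments *)

(** Everything is sized so that each error is at most h e + K h^2, where K may depend on e. This
    forces the bad event to have probability o(h), and fixes the choice of moment: second moments of
    the increments give only order h, and a union bound over the 2^m increments of level m that is
    not summable, whereas fourth moments give h^2 with geometric decay in m. The dyadic grid is that
    of [0, h] itself, so h^2 factors out of all levels at once. Working with countably many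
    increments also makes the bad event measurable without speaking of suprema of paths that are
    continuous only almost surely. On the bad event the Brownian increment W is still unbounded.
    There |W| and W^2 are dominated by 1 + W^4: the constant is paid for by the probability of the
    event and W^4 by its mean over the whole space, both of order h^2, so no estimate of W
    restricted to the event is needed. *)

Lemma ge0_integral_density d (T : measurableType d) (R : realType)
    (nu mu : {measure set T -> \bar R}) (A : set T) (g f : T -> R) :
  measurable A -> measurable_fun A g -> (forall y, A y -> 0 <= g y) ->
  (forall E, measurable E -> E `<=` A ->
    nu E = \int[mu]_(y in E) (g y)%:E)%E ->
  measurable_fun A f -> (forall y, A y -> 0 <= f y) ->
  (\int[nu]_(y in A) (f y)%:E = \int[mu]_(y in A) (f y * g y)%:E)%E.
Proof.
move=> mA mg g0 nuE mf f0.
have mf' : measurable_fun A (EFin \o f) by exact/measurable_EFinP.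
(* Simple functions reduce the formula to level sets cut by [A], so knowing [nu] on subsets of [A]
   suffices. This local form matters because [p] is a density on the chamber only. *)
pose h := nnsfun_approx mA mf'.
have hE y : A y -> (h n y)%:E @[n --> \oo] --> (f y)%:E.
  by move=> Ay; apply: cvg_nnsfun_approx => // z Az; rewrite lee_fin f0.
have mh n : measurable_fun A (h n) by exact: measurable_funTS.
have hg n : (\int[nu]_(y in A) (h n y)%:E =
    \int[mu]_(y in A) (h n y * g y)%:E)%E.
  transitivity (\int[nu]_(y in A)
      (\sum_(r \in range (h n)) (r * \1_(h n @^-1` [set r]) y)%:E))%E.
    by apply: eq_integral => t tE; rewrite /= {1}fimfunE -fsumEFin.
  rewrite ge0_integral_fsum//; last 2 first.
    - by move=> r; apply/measurable_EFinP; exact: measurable_funM.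
    - by move=> m y Ay; exact: nnfun_muleindic_ge0.
  transitivity (\int[mu]_(y in A)
      (\sum_(r \in range (h n)) (r * \1_(h n @^-1` [set r]) y * g y)%:E))%E;
    last first.
    apply: eq_integral => y yA; rewrite fimfunE.
    rewrite EFinM -fsumEFin// ge0_mule_fsuml//.
    by move=> r; exact: nnfun_muleindic_ge0.
  rewrite ge0_integral_fsum//; last 2 first.
    - move=> r; apply/measurable_EFinP/measurable_funM => //.
      exact: measurable_funM.
    - move=> r y Ay; rewrite EFinM mule_ge0 ?lee_fin ?g0//.
      exact: nnfun_muleindic_ge0.
  apply: eq_fsbigr => r; rewrite inE => -[t _ hr].
  have r0 : 0 <= r by rewrite -hr.
  have mhr : measurable (h n @^-1` [set r]) by exact: measurable_sfunP.
  under eq_integral do rewrite EFinM.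
  rewrite ge0_integralZl//; last 1 first.
    - by apply/measurable_EFinP; exact: measurable_indic.
  rewrite integral_indic// nuE//; last exact: measurableI.
  under [RHS]eq_integral do rewrite -mulrA EFinM.
  rewrite ge0_integralZl//; last 2 first.
    - by apply/measurable_EFinP; exact: measurable_funM.
    - by move=> y Ay; rewrite lee_fin mulr_ge0 ?g0.
  congr *%E.
  rewrite setIC integral_mkcondr; apply: eq_integral => y yA.
  by rewrite EFinM muleC epatch_indic.
have -> : (\int[nu]_(y in A) (f y)%:E =
    limn (fun n => \int[nu]_(y in A) (h n y)%:E))%E.
  under eq_integral => y /[!inE] yA.
    rewrite -(cvg_lim _ (hE _ yA))//; over.
  apply: monotone_convergence => //.
  - by move=> n; exact/measurable_EFinP.
  - by move=> n y Ay; rewrite lee_fin.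
  - by move=> y Ay a b ab; rewrite lee_fin; exact/lefP/nd_nnsfun_approx.
have -> : (\int[mu]_(y in A) (f y * g y)%:E =
    limn (fun n => \int[mu]_(y in A) (h n y * g y)%:E))%E.
  rewrite -monotone_convergence//.
  - apply: eq_integral => y /[!inE] Ay; apply/esym/cvg_lim => //.
    under eq_fun do rewrite EFinM.
    rewrite EFinM.
    by apply: cvgeZr => //; exact: hE.
  - by move=> n; apply/measurable_EFinP; exact: measurable_funM.
  - by move=> n y Ay; rewrite lee_fin mulr_ge0 ?g0.
  - move=> y Ay a b ab; rewrite lee_fin ler_wpM2r ?g0//.
    exact/lefP/nd_nnsfun_approx.
by under eq_fun do rewrite hg.
Qed.

Lemma Rintegral_cst_probability d (T : measurableType d) (R : realType)
  (P : probability T R) (c : R) : \int[P]_w c = c.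
Proof.
rewrite Rintegral_cst//.
rewrite -[RHS]mulr1; congr *%R.
exact: (congr1 fine (probability_setT P)).
Qed.

Section gaussian_moments.
Context d (Omega : measurableType d) (R : realType) (P : probability Omega R).
Variables (s : R) (W : Omega -> R).
Hypothesis s_gt0 : 0 < s.
Hypothesis mW : measurable_fun setT W.
Hypothesis lawW : forall A : set R, measurable A ->
  P (W @^-1` A) = normal_prob 0 s A.

Lemma ge0_expectation_gaussian (f : R -> R) :
  measurable_fun setT f -> (forall y, 0 <= f y) ->
  (\int[P]_w (f (W w))%:E =
   \int[lebesgue_measure]_x (f x * normal_pdf 0 s x)%:E)%E.
Proof.
move=> mf f0.
rewrite -(@ge0_integral_density _ _ _ (normal_prob 0 s))//; last 2 first.
  - exact: measurable_normal_pdf.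
  - by move=> y _; exact: normal_pdf_ge0.
pose mW' := isMeasurableFun.Build _ _ _ (measurableTypeR R) _ mW.
pose W' : {mfun Omega >-> measurableTypeR R} :=
  HB.pack (W : Omega -> measurableTypeR R) mW'.
rewrite (eq_measure_integral (distribution P W')) => [|A mA _]; last first.
  exact/esym/lawW.
rewrite ge0_integral_pushforward//=; first exact/measurable_EFinP.
by move=> y _; rewrite lee_fin.
Qed.

(* Tilting the centered density by expR (t * x) translates it, and tilting it by
   a multiple of x ^+ 2 rescales its deviation to s / r. With 1 + u <= expR u the
   first two moments follow, letting t -> 0 and r -> 1 from both sides. *)
Lemma gaussian_exp t :
  (\int[P]_w (expR (t * W w))%:E = (expR (t ^+ 2 * s ^+ 2 / 2))%:E)%E.
Proof.
rewrite (@ge0_expectation_gaussian (fun x => expR (t * x))); last 2 first.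
  - by apply: measurableT_comp => //; exact: measurable_funM.
  - by move=> y; exact: expR_ge0.
transitivity (\int[lebesgue_measure]_x
    ((expR (t ^+ 2 * s ^+ 2 / 2))%:E * (normal_pdf (t * s ^+ 2) s x)%:E))%E.
  apply: eq_integral => x _; rewrite -EFinM; congr EFin.
  rewrite !normal_pdfE ?gt_eqF// /normal_fun mulrCA [RHS]mulrCA; congr *%R.
  rewrite -!expRD; congr expR; field.
  by rewrite gt_eqF.
rewrite integralZl//; last exact: integrable_normal_pdf.
by rewrite integral_normal_pdf mule1.
Qed.

Lemma gaussian_exp_sqr r : 0 < r ->
  (\int[P]_w (expR ((1 - r ^+ 2) / (2 * s ^+ 2) * W w ^+ 2))%:E = (r^-1)%:E)%E.
Proof.
move=> r0.
rewrite (@ge0_expectation_gaussian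
    (fun x => expR ((1 - r ^+ 2) / (2 * s ^+ 2) * x ^+ 2))); last 2 first.
  - by apply: measurableT_comp => //; exact: measurable_funM.
  - by move=> y; exact: expR_ge0.
transitivity (\int[lebesgue_measure]_x
    ((r^-1)%:E * (normal_pdf 0 (s / r) x)%:E))%E.
  apply: eq_integral => x _; rewrite -EFinM; congr EFin.
  have sr0 : 0 < s / r by rewrite divr_gt0.
  rewrite !normal_pdfE ?gt_eqF// /normal_fun mulrCA [RHS]mulrA; congr *%R.
    rewrite /normal_peak.
    have -> : (s / r) ^+ 2 * pi *+ 2 = (r^-1) ^+ 2 * (s ^+ 2 * pi *+ 2).
      by rewrite -!mulrnAr mulrA exprMn [X in X * _]mulrC.
    rewrite sqrtrM ?sqr_ge0// sqrtr_sqr gtr0_norm ?invr_gt0// invfM invrK.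
    by rewrite mulrA mulVf ?mul1r// gt_eqF.
  rewrite -!expRD; congr expR; field.
  by rewrite !gt_eqF.
rewrite integralZl//; last exact: integrable_normal_pdf.
by rewrite integral_normal_pdf mule1.
Qed.

Lemma gaussian_exp_integrable t :
  P.-integrable setT (fun w => (expR (t * W w))%:E).
Proof.
apply/integrableP; split.
  apply/measurable_EFinP; apply: measurableT_comp => //.
  exact: measurable_funM.
under eq_integral do rewrite gee0_abs ?lee_fin ?expR_ge0//.
by rewrite gaussian_exp ltry.
Qed.

Lemma gaussian_exp_sqr_integrable r : 0 < r -> P.-integrable setT
  (fun w => (expR ((1 - r ^+ 2) / (2 * s ^+ 2) * W w ^+ 2))%:E).
Proof.
move=> r0; apply/integrableP; split.
  apply/measurable_EFinP; apply: measurableT_comp => //.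
  by apply: measurable_funM => //; exact: measurable_funX.
under eq_integral do rewrite gee0_abs ?lee_fin ?expR_ge0//.
by rewrite gaussian_exp_sqr// ltry.
Qed.

(** The exponent u is the tilt with r = 1/2, whose exponential moment is 1/r = 2. Then W^4 = (64/9)
    s^4 u^2 and u^2 / 2 <= exp u give the factor 128/9, rounded up to 16. The resulting bound 32 s^4
    is not sharp; only its order matters. *)
Let fourth_le w :
  W w ^+ 4 <= 16 * s ^+ 4 * expR ((1 - 2^-1 ^+ 2) / (2 * s ^+ 2) * W w ^+ 2).
Proof.
set u := _ * W w ^+ 2; have u0 : 0 <= u.
  apply: mulr_ge0; last exact: sqr_ge0.
  apply: divr_ge0; first by rewrite expr2; lra.
  by rewrite mulr_ge0 ?sqr_ge0.
have uE : W w ^+ 4 = 64 / 9 * s ^+ 4 * u ^+ 2.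
  by rewrite /u; field; rewrite gt_eqF.
have := @expR_ge1Dxn _ u 1 u0; rewrite (_ : 2`! = 2)%N// => eu.
rewrite uE -subr_ge0.
have -> : 16 * s ^+ 4 * expR u - 64 / 9 * s ^+ 4 * u ^+ 2 =
  s ^+ 4 * (16 * expR u - 64 / 9 * u ^+ 2) by ring.
apply: mulr_ge0; first by rewrite exprn_ge0// ltW.
have := sqr_ge0 u; lra.
Qed.

Lemma gaussian_fourth_integrable : P.-integrable setT (fun w => (W w ^+ 4)%:E).
Proof.
have h0 : 0 < 2^-1 :> R by lra.
apply: (@le_integrable _ _ _ P setT measurableT _
  (fun w => (16 * s ^+ 4 *
     expR ((1 - 2^-1 ^+ 2) / (2 * s ^+ 2) * W w ^+ 2))%:E)).
- by apply/measurable_EFinP; exact: measurable_funX.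
- move=> w _; rewrite !gee0_abs ?lee_fin ?fourth_le//.
    by rewrite !mulr_ge0 ?expR_ge0 ?exprn_ge0// ltW.
  by rewrite (exprM _ 2 2) sqr_ge0.
- under eq_fun do rewrite EFinM.
  by apply: integrableZl => //; exact: gaussian_exp_sqr_integrable.
Qed.

Lemma gaussian_fourth_le : \int[P]_w (W w ^+ 4) <= 32 * s ^+ 4.
Proof.
have h0 : 0 < 2^-1 :> R by lra.
apply: (@le_trans _ _ (\int[P]_w (16 * s ^+ 4 *
     expR ((1 - 2^-1 ^+ 2) / (2 * s ^+ 2) * W w ^+ 2)))).
  apply: le_Rintegral => //; first exact: gaussian_fourth_integrable.
  rewrite /comp; under eq_fun do rewrite EFinM.
  by apply: integrableZl => //; exact: gaussian_exp_sqr_integrable.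
rewrite RintegralZl//; last exact: gaussian_exp_sqr_integrable.
rewrite /Rintegral gaussian_exp_sqr//= invrK; lra.
Qed.

Lemma gaussian_sqr_integrable : P.-integrable setT (fun w => (W w ^+ 2)%:E).
Proof.
apply: (@le_integrable _ _ _ P setT measurableT _
  (fun w => (1 + W w ^+ 4)%:E)).
- by apply/measurable_EFinP; exact: measurable_funX.
- move=> w _; rewrite !gee0_abs ?lee_fin//.
  + by have := sqr_ge0 (W w ^+ 2 - 2^-1); rewrite (exprM _ 2 2); nra.
  + by rewrite (exprM _ 2 2) addr_ge0 ?sqr_ge0.
  + exact: sqr_ge0.
- under eq_fun do rewrite EFinD.
  apply: integrableD => //; last exact: gaussian_fourth_integrable.
  exact: finite_measure_integrable_cst.
Qed.

Lemma gaussian_integrable : P.-integrable setT (fun w => (W w)%:E).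
Proof.
apply: (@le_integrable _ _ _ P setT measurableT _
  (fun w => (1 + W w ^+ 2)%:E)).
- exact/measurable_EFinP.
- move=> w _; rewrite lee_fin [leRHS]ger0_norm ?addr_ge0 ?sqr_ge0//.
  have := sqr_ge0 (`|W w| - 1).
  rewrite -[in X in _ -> X](real_normK (num_real (W w))).
  have := normr_ge0 (W w); nra.
- under eq_fun do rewrite EFinD.
  apply: integrableD => //; last exact: gaussian_sqr_integrable.
  exact: finite_measure_integrable_cst.
Qed.

Lemma gaussian_mean : \int[P]_w W w = 0.
Proof.
set m := Rintegral _ _ _.
have mE t : 1 + t * m <= expR (t ^+ 2 * s ^+ 2 / 2).
  have -> : 1 + t * m = \int[P]_w (1 + t * W w).
    rewrite RintegralD//; last 2 first.
    - exact: finite_measure_integrable_cst.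
    - rewrite /comp; under eq_fun do rewrite EFinM.
      by apply: integrableZl => //; exact: gaussian_integrable.
    rewrite Rintegral_cst_probability RintegralZl//.
    exact: gaussian_integrable.
  apply: (@le_trans _ _ (\int[P]_w expR (t * W w))).
    apply: le_Rintegral => //.
    - rewrite /comp; under eq_fun do rewrite EFinD EFinM.
      apply: integrableD => //; first exact: finite_measure_integrable_cst.
      by apply: integrableZl => //; exact: gaussian_integrable.
    - exact: gaussian_exp_integrable.
    - by move=> w _; exact: expR_ge1Dx.
  by rewrite /Rintegral gaussian_exp.
(* With v = t^2 s^2 <= 1, exp (v/2) <= 1 / (1 - v/2) <= 1 + v, which leaves t m <= v. *)
have {}mE t : t ^+ 2 * s ^+ 2 <= 1 -> t * m <= t ^+ 2 * s ^+ 2.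
  move=> t1; have := mE t.
  have := expR_ge1Dx (- (t ^+ 2 * s ^+ 2 / 2)); rewrite expRN.
  set v := t ^+ 2 * s ^+ 2 in t1 *.
  have v0 : 0 <= v by rewrite mulr_ge0 ?sqr_ge0.
  move=> a b; have e0 := expR_gt0 (v / 2).
  have : expR (v / 2) * (1 - v / 2) <= 1.
    by rewrite -[leRHS](mulfV (lt0r_neq0 e0)) ler_wpM2l// ltW.
  nra.
apply/eqP; apply: contraT => m0.
have s2 : 0 < s ^+ 2 by rewrite exprn_gt0.
have am : 0 < m ^+ 2 by rewrite exprn_even_gt0.
(* The test value is t = c m. The summand m^2 s^2 of the denominator keeps t^2 s^2 <= 1, and s^2 + 1
   gives c s^2 < 1, contradicting c m^2 <= (c s^2) (c m^2). *)
pose c := (m ^+ 2 * s ^+ 2 + s ^+ 2 + 1)^-1.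
have c0 : 0 < c by rewrite invr_gt0; nra.
have cE : c * (m ^+ 2 * s ^+ 2 + s ^+ 2 + 1) = 1.
  by rewrite mulVf// gt_eqF//; nra.
have cs : c * s ^+ 2 < 1 by nra.
have cm : c * m ^+ 2 * s ^+ 2 < 1 by nra.
have := mE (c * m).
have -> : (c * m) ^+ 2 * s ^+ 2 = (c * s ^+ 2) * (c * m ^+ 2) by ring.
have c1 : c * (m ^+ 2 * s ^+ 2) <= 1 by nra.
have -> : c * m * m = c * m ^+ 2 by ring.
have p0 : 0 < c * m ^+ 2 by nra.
move=> H.
have h1 : c * s ^+ 2 * (c * m ^+ 2) <= 1.
  have -> : c * s ^+ 2 * (c * m ^+ 2) = (c * m ^+ 2 * s ^+ 2) * c by ring.
  have : c <= 1 by nra.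
  nra.
by have := H h1; nra.
Qed.

Lemma gaussian_variance : \int[P]_w (W w ^+ 2) = s ^+ 2.
Proof.
set m := Rintegral _ _ _.
have s2 : 0 < s ^+ 2 by rewrite exprn_gt0.
have m0 : 0 <= m by apply: Rintegral_ge0 => w _; exact: sqr_ge0.
(* The factor 1 - r stays on both sides: its sign turns this single inequality into an upper bound
   on m for r < 1 and a lower bound for r > 1. *)
have mE r : 0 < r -> (1 - r) * (m * r * (1 + r)) <= (1 - r) * (2 * s ^+ 2).
  move=> r0; pose k := (1 - r ^+ 2) / (2 * s ^+ 2).
  have : 1 + k * m <= r^-1.
    have -> : 1 + k * m = \int[P]_w (1 + k * W w ^+ 2).
      rewrite RintegralD//; last 2 first.
      - exact: finite_measure_integrable_cst.
      - rewrite /comp; under eq_fun do rewrite EFinM.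
        by apply: integrableZl => //; exact: gaussian_sqr_integrable.
      rewrite Rintegral_cst_probability RintegralZl//.
      exact: gaussian_sqr_integrable.
    apply: (@le_trans _ _ (\int[P]_w expR (k * W w ^+ 2))).
      apply: le_Rintegral => //.
      - rewrite /comp; under eq_fun do rewrite EFinD EFinM.
        apply: integrableD => //; first exact: finite_measure_integrable_cst.
        by apply: integrableZl => //; exact: gaussian_sqr_integrable.
      - exact: gaussian_exp_sqr_integrable.
      - by move=> w _; exact: expR_ge1Dx.
    by rewrite /Rintegral gaussian_exp_sqr.
  rewrite -(ler_pM2r r0) mulVf ?gt_eqF// -(ler_pM2l s2) => H.
  have : s ^+ 2 * ((1 + k * m) * r) =
    s ^+ 2 * r + (1 - r) * (m * r * (1 + r)) / 2.
    by rewrite /k; field; rewrite gt_eqF.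
  lra.
apply/eqP; rewrite eq_le; apply/andP; split;
  apply: contraT; rewrite -ltNge => ms.
(* At r = 1 - e, m r (1 + r) >= 2 m - 3 e m > 2 s^2, since 4 e m = m - s^2. The other case takes r =
   1 + e; dividing by the larger of m and s^2 keeps e < 1. *)
- pose e := (m - s ^+ 2) / (4 * m).
  have mgt0 : 0 < m by lra.
  have e0 : 0 < e by rewrite divr_gt0//; lra.
  have eE : e * m * 4 = m - s ^+ 2.
    by rewrite /e; field; rewrite gt_eqF.
  have e1 : e < 1 by nra.
  have := mE (1 - e); rewrite subr_gt0 => /(_ e1).
  have -> : 1 - (1 - e) = e by ring.
  rewrite ler_pM2l//; nra.
- pose e := (s ^+ 2 - m) / (4 * s ^+ 2).
  have e0 : 0 < e by rewrite divr_gt0//; lra.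
  have eE : e * s ^+ 2 * 4 = s ^+ 2 - m.
    by rewrite /e; field; rewrite gt_eqF.
  have e1 : e < 1 by nra.
  have /mE : 0 < 1 + e by lra.
  have -> : 1 - (1 + e) = - e by ring.
  rewrite ler_nM2l ?oppr_lt0//.
  have em0 : e * m < e * s ^+ 2 by nra.
  have : e * e * m <= e * m by rewrite -mulrA; nra.
  have -> : m * (1 + e) * (1 + (1 + e)) =
    2 * m + 3 * (e * m) + e * e * m by ring.
  nra.
Qed.

End gaussian_moments.

(* The joint law agrees with the product of the marginals on rectangles, hence
   everywhere, and Fubini's theorem applies. *)
Lemma Rintegral_prod_independent d (Omega : measurableType d) (R : realType)
    (P : probability Omega R) (X Y : Omega -> R) :
  P.-integrable setT (EFin \o X) -> P.-integrable setT (EFin \o Y) ->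
  P.-integrable setT (fun w => (X w * Y w)%:E) ->
  (forall A B : set R, measurable A -> measurable B ->
    P (X @^-1` A `&` Y @^-1` B) = (P (X @^-1` A) * P (Y @^-1` B))%E) ->
  \int[P]_w (X w * Y w) = \int[P]_w X w * \int[P]_w Y w.
Proof.
move=> iX iY iXY indep.
have /measurable_EFinP mX : measurable_fun setT (EFin \o X).
  exact: measurable_int iX.
have /measurable_EFinP mY : measurable_fun setT (EFin \o Y).
  exact: measurable_int iY.
have mXY : measurable_fun setT (fun w => (X w, Y w)).
  exact: measurable_fun_pair.
pose X' : {mfun Omega >-> R} := HB.pack X (isMeasurableFun.Build _ _ _ _ _ mX).
pose Y' : {mfun Omega >-> R} := HB.pack Y (isMeasurableFun.Build _ _ _ _ _ mY).
pose XY' : {mfun Omega >-> (R * R)%type} :=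
  HB.pack (fun w => (X w, Y w)) (isMeasurableFun.Build _ _ _ _ _ mXY).
pose f (z : R * R) := (z.1 * z.2)%:E.
have mf : measurable_fun setT f.
  by apply/measurable_EFinP; apply: measurable_funM.
have jointE Z : measurable Z ->
    (distribution P X' \x distribution P Y')%E Z = distribution P XY' Z.
  move=> mZ.
  by apply: product_measure_unique => // A B mA mB; exact: indep.
have E1 : (\int[P]_w (X w * Y w)%:E =
    \int[distribution P X' \x distribution P Y']_z f z)%E.
  rewrite (eq_measure_integral (distribution P XY')); last first.
    by move=> Z mZ _; exact: jointE.
  by rewrite integral_distribution//.
have if_ : (distribution P X' \x distribution P Y')%E.-integrable setT f.
  have iXY' : (distribution P XY').-integrable setT f.
    exact: integrable_pushforward.
  move/integrableP : iXY' => [_ H]; apply/integrableP; split => //.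
  by rewrite (eq_measure_integral (distribution P XY'))// => Z mZ _;
    exact: jointE.
rewrite /Rintegral E1 -integral12_prod_meas1// /fubini_F /f /=.
have mE : measurable_fun setT (fun y : R => y%:E).
  by apply: (@measurable_EFinP _ _ _ setT id).2; exact: measurable_id.
have iY' : (distribution P Y').-integrable setT (fun y : R => y%:E).
  by apply: integrable_pushforward.
have -> : (\int[distribution P X']_x \int[distribution P Y']_y (x * y)%:E =
   \int[distribution P X']_x (x%:E * \int[P]_w (Y w)%:E))%E.
  apply: eq_integral => x _; under eq_integral do rewrite EFinM.
  by rewrite integralZl// integral_distribution.
have finY : (\int[P]_w (Y w)%:E)%E \is a fin_num by exact: integrable_fin_num.
have finX : (\int[P]_w (X w)%:E)%E \is a fin_num by exact: integrable_fin_num.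
rewrite -(fineK finY) integralZr//; last first.
  by apply: integrable_pushforward.
rewrite integral_distribution//.
by rewrite fineM.
Qed.

(** * Dyadic control of Brownian paths *)

Section dyadic_chaining.
Variable R : realType.
Implicit Types (a h : R) (f : R -> R).

Definition dyadic (h : R) (m k : nat) : R := h * k%:R / 2 ^+ m.

(* The tolerance at level [m] is [a * theta ^+ m * (1 - theta)] with
   [theta = 9/10]: these sum to [a], while [2 * theta ^+ 4 > 1] makes the
   fourth-moment union bound over the [2 ^ m] increments summable in [m]. *)
Definition dyadic_tol (a : R) (m : nat) : R := a * (9 / 10) ^+ m / 10.

Definition small_dyadic_increments (a h : R) (f : R -> R) :=
  forall m k, (k < 2 ^ m)%N ->
    `|f (dyadic h m k.+1) - f (dyadic h m k)| <= dyadic_tol a m.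

Lemma dyadic_double h m k : dyadic h m.+1 k.*2 = dyadic h m k.
Proof.
rewrite /dyadic -muln2 natrM exprS; field.
by rewrite expf_neq0.
Qed.

(** The tolerances of levels 0 to m sum to a (1 - theta^(m+1)). A point with odd index at a new
    level is one increment away from its left neighbour, which already belongs to the previous
    level. *)
Lemma dyadic_sup_level a h f : 0 <= a -> f 0 = 0 ->
  small_dyadic_increments a h f ->
  forall m k, (k <= 2 ^ m)%N ->
    `|f (dyadic h m k)| <= a * (1 - (9 / 10) ^+ m.+1).
Proof.
move=> a0 f0 small; elim=> [|m IH] k.
  rewrite expn0 => k1; case: k k1 => [_|[_|//]].
    rewrite /dyadic mulr0 mul0r f0 normr0 expr1; lra.
  have := small 0%N 0%N isT; rewrite {2}/dyadic mulr0 mul0r f0 subr0.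
  rewrite /dyadic_tol expr0 expr1; lra.
rewrite expnS mul2n -[k]odd_double_half.
set q := (9 / 10) ^+ m.+1 in IH *.
have q0 : 0 <= q by rewrite exprn_ge0; lra.
have qS : (9 / 10) ^+ m.+2 = (9 / 10) * q by rewrite exprS.
case: (odd k) => /=; last first.
  rewrite add0n leq_double => /IH; rewrite -dyadic_double qS; nra.
rewrite add1n ltn_double => kk.
have /IH := ltnW kk; rewrite -dyadic_double.
have := small m.+1 k./2.*2; rewrite expnS mul2n ltn_double => /(_ kk).
rewrite /dyadic_tol -/q qS.
set u := f (dyadic _ _ _.+1); set v := f _ => uv vq.
have : `|u| <= `|u - v| + `|v| by rewrite -[in leLHS](subrK v u) ler_normD.
nra.
Qed.

(** Dyadic points are dense: by continuity an overshoot |f s| > a would persist at the grid point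
    just left of s on a fine enough level. *)
Lemma small_dyadic_increments_sup a h f : 0 <= a -> 0 < h -> f 0 = 0 ->
  (forall s, 0 <= s -> forall e, 0 < e -> exists2 r, 0 < r &
    forall t, 0 <= t -> `|t - s| < r -> `|f t - f s| < e) ->
  small_dyadic_increments a h f ->
  forall s, 0 <= s <= h -> `|f s| <= a.
Proof.
move=> a0 h0 f0 fc small s /andP[s0 sh]; rewrite leNgt; apply/negP => fsa.
have [|r r0 fr] := fc s s0 (`|f s| - a); first by rewrite subr_gt0.
have [m hm] : exists m : nat, h / r < 2 ^+ m.
  exists (Num.truncn (h / r)).+1; apply: (lt_trans (truncnS_gt _)).
  by rewrite -natrX ltr_nat ltn_expl.
have p0 : 0 < 2 ^+ m :> R by rewrite exprn_gt0.
pose k := Num.truncn (s * 2 ^+ m / h).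
have /andP[k1 k2] : k%:R <= s * 2 ^+ m / h < k.+1%:R.
  by rewrite truncn_itv// divr_ge0 ?mulr_ge0// ltW.
have km : (k <= 2 ^ m)%N.
  rewrite -(ler_nat R) natrX (le_trans k1)// ler_pdivrMr// mulrC.
  by rewrite ler_pM2l.
have := dyadic_sup_level a0 f0 small km.
have d0 : 0 <= dyadic h m k by rewrite divr_ge0 ?mulr_ge0//; exact: ltW.
have q0 : 0 <= (9 / 10) ^+ m.+1 :> R by rewrite exprn_ge0; lra.
have ds : `|dyadic h m k - s| < r.
  have hr : h / 2 ^+ m < r by rewrite ltr_pdivrMr// mulrC -ltr_pdivrMr.
  have e1 : dyadic h m k <= s.
    move: k1; rewrite /dyadic ler_pdivlMr// mulrC => k1.
    by rewrite ler_pdivrMr.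
  have e2 : s < dyadic h m k + h / 2 ^+ m.
    move: k2; rewrite /dyadic ltr_pdivrMr// => k2.
    rewrite -mulrDl ltr_pdivlMr//; move: k2; rewrite -natr1; lra.
  rewrite ler0_norm; lra.
have := fr _ d0 ds.
have : `|f s| <= `|f (dyadic h m k) - f s| + `|f (dyadic h m k)|.
  by rewrite distrC -[in leLHS](subrK (f (dyadic h m k)) (f s)) ler_normD.
nra.
Qed.

End dyadic_chaining.

Lemma probability_bigcup_geometric d (T : measurableType d) (R : realType)
    (P : {measure set T -> \bar R}) (F : (set T)^nat) (c q : R) :
  0 <= c -> 0 <= q < 1 -> (forall m, measurable (F m)) ->
  (forall m, (P (F m) <= (c * q ^+ m)%:E)%E) ->
  (P (\bigcup_m F m) <= (c / (1 - q))%:E)%E.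
Proof.
move=> c0 /andP[q0 q1] mF PF.
apply: (@le_trans _ _ (\sum_(m <oo) P (F m))%E).
  by apply: measure_sigma_subadditive => //; exact: bigcup_measurable.
apply: lime_le; first exact: is_cvg_nneseries.
apply: nearW => n.
apply: (@le_trans _ _ (\sum_(0 <= m < n) (c * q ^+ m)%:E)%E).
  by apply: lee_sum => m _; exact: PF.
rewrite sumEFin lee_fin.
have -> : \sum_(0 <= m < n) c * q ^+ m = series (geometric c q) n by [].
rewrite geometric_seriesE ?lt_eqF//=.
rewrite ler_pM2r ?invr_gt0 ?subr_gt0//.
by rewrite ler_piMr// gerBl exprn_ge0.
Qed.

Lemma measurable_norm_gt d (T : measurableType d) (R : realType) (W : T -> R)
    (c : R) : measurable_fun setT W -> measurable [set w | c < `|W w|].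
Proof.
move=> mW.
rewrite [X in measurable X](_ : _ = (Num.norm \o W) @^-1` `]c, +oo[);
  last by apply/seteqP; split => w /=; rewrite in_itv/= andbT.
by rewrite -[X in measurable X]setTI; apply: measurableT_comp.
Qed.

(** Markov's inequality for the fourth power. *)
Lemma probability_fourth_moment d (T : measurableType d) (R : realType)
    (P : probability T R) (W : T -> R) (c s : R) : 0 < c -> 0 < s ->
  measurable_fun setT W ->
  (forall A : set R, measurable A -> P (W @^-1` A) = normal_prob 0 s A) ->
  (P [set w | (c < `|W w|)%R] <= (32 * s ^+ 4 / c ^+ 4)%:E)%E.
Proof.
move=> c0 s0 mW lawW.
have c4 : 0 < c ^+ 4 by rewrite exprn_gt0.
have mA : measurable [set w | c < `|W w|] by exact: measurable_norm_gt.
have i4 := gaussian_fourth_integrable s0 mW lawW.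
rewrite EFinM lee_pdivlMr// muleC.
apply: (@le_trans _ _ (\int[P]_w (W w ^+ 4)%:E)%E); last first.
  rewrite -[leLHS]fineK; last exact: integrable_fin_num.
  by rewrite lee_fin; exact: gaussian_fourth_le.
rewrite -(setIT [set w | _]) -integral_indic//.
rewrite -ge0_integralZl//; last 2 first.
- by apply/measurable_EFinP; exact: measurable_indic.
- by rewrite lee_fin ltW.
apply: ge0_le_integral => //.
- by move=> w _; rewrite -EFinM lee_fin mulr_ge0// ltW.
- apply/measurable_EFinP; apply: measurable_funM => //.
- by apply/measurable_EFinP; exact: measurable_funX.
- move=> w _; rewrite -EFinM lee_fin indicE.
  have W4 : 0 <= W w ^+ 4 by rewrite (exprM _ 2 2) sqr_ge0.
  case: (boolP (w \in _)); rewrite ?mulr0 ?mulr1// inE/= => cW.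
  have -> : W w ^+ 4 = `|W w| ^+ 4 by rewrite -normrX ger0_norm.
  by rewrite lerXn2r ?nnegrE// ltW.
Qed.

Lemma measure_bigcup_fin_le d (T : measurableType d) (R : realType)
    (P : {measure set T -> \bar R}) (I : finType) (A : I -> set T) (c : R) :
  (forall i, measurable (A i)) -> (forall i, (P (A i) <= c%:E)%E) ->
  (P (\bigcup_i A i) <= (#|I|%:R * c)%:E)%E.
Proof.
move=> mA PA.
apply: (@le_trans _ _ (\sum_(i \in [set: I]) P (A i))%E).
  apply: content_sub_fsum => //.
  - exact: finite_finset.
  - by apply: fin_bigcup_measurable => // ; exact: finite_finset.
have -> : [set: I] = [set` index_enum I].
  by apply/seteqP; split => i //= _; exact: mem_index_enum.
rewrite -fsbig_seq ?index_enum_uniq//.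
apply: (@le_trans _ _ (\sum_(i : I) c%:E)%E); first exact: lee_sum.
by rewrite sumEFin lee_fin sumr_const mulr_natl.
Qed.

(** A level-m increment has variance h / 2^m, so it exceeds its tolerance with probability at most
    32 (h / 2^m)^2 / tol^4. Over the N 2^m increments of that level this adds up to K h^2 q^m with q
    = 1 / (2 theta^4) = 10000/13122 < 1, and the geometric series converges. K depends on a but not
    on h. *)
Lemma brownian_small_increments d (Omega : measurableType d) (R : realType)
    (P : probability Omega R) (N : nat) (B : R -> Omega -> 'rV[R]_N) (a : R) :
  brownian_motion P B -> 0 < a ->
  exists2 K : R, 0 <= K & forall h, 0 < h -> exists E : set Omega,
    [/\ measurable E, (P E <= (K * h ^+ 2)%:E)%E & forall w, ~ E w ->
      forall i, small_dyadic_increments a h (fun t => B t w ord0 i)].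
Proof.
move=> HB a0.
pose q : R := (2 * (9 / 10) ^+ 4)^-1.
pose K : R := N%:R * 32 * (10 / a) ^+ 4.
have th4 : (9 / 10) ^+ 4 = 6561 / 10000 :> R.
  by rewrite !exprS expr0; lra.
have q01 : 0 <= q < 1.
  rewrite /q th4 invr_ge0; apply/andP; split; first lra.
  by rewrite invf_lt1; lra.
have K0 : 0 <= K.
  by apply: mulr_ge0; [exact: mulr_ge0|rewrite exprn_ge0// divr_ge0// ltW].
exists (K / (1 - q)).
  by rewrite divr_ge0// subr_ge0 ltW//; case/andP: q01.
move=> h h0.
pose A m (ki : 'I_(2 ^ m) * 'I_N) := [set w | dyadic_tol a m <
  `|B (dyadic h m ki.1.+1) w ord0 ki.2 - B (dyadic h m ki.1) w ord0 ki.2|].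
have d0 m k : 0 <= dyadic h m k.
  by rewrite /dyadic divr_ge0// ?exprn_ge0// mulr_ge0// ltW.
have tol0 m : 0 < dyadic_tol a m.
  by rewrite /dyadic_tol divr_gt0// mulr_gt0// exprn_gt0.
have mB t i : 0 <= t -> measurable_fun setT (fun w => B t w ord0 i).
  move=> t0; exact: measurableT_comp (measurable_coord i) (bm_measurable HB t0).
have mI m k i : measurable_fun setT
    (fun w => B (dyadic h m k.+1) w ord0 i - B (dyadic h m k) w ord0 i).
  by apply: measurable_funB; exact: mB.
have mA m ki : measurable (A m ki).
  exact: (measurable_norm_gt _ (mI _ _ _)).
have PA m ki : (P (A m ki) <=
    (32 * (h / 2 ^+ m) ^+ 2 / dyadic_tol a m ^+ 4)%:E)%E.
  have hm : 0 < h / 2 ^+ m by rewrite divr_gt0// exprn_gt0.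
  have dd : dyadic h m ki.1.+1 - dyadic h m ki.1 = h / 2 ^+ m.
    by rewrite /dyadic -natr1; field; rewrite expf_neq0.
  have -> : (h / 2 ^+ m) ^+ 2 = Num.sqrt (h / 2 ^+ m) ^+ 4.
    by rewrite (exprM _ 2 2) sqr_sqrtr// ltW.
  apply: probability_fourth_moment => //; first by rewrite sqrtr_gt0.
  move=> C mC; rewrite -dd.
  apply: (bm_gaussian HB) => //; rewrite d0/= -subr_gt0 dd//.
exists (\bigcup_m \bigcup_ki A m ki); split.
- apply: bigcup_measurable => m _.
  by apply: fin_bigcup_measurable => //; exact: finite_finset.
- rewrite (_ : K / (1 - q) * h ^+ 2 = (K * h ^+ 2) / (1 - q)); last by ring.
  apply: probability_bigcup_geometric => //.
  + by rewrite mulr_ge0// sqr_ge0.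
  + move=> m; apply: fin_bigcup_measurable => //; exact: finite_finset.
  + move=> m; apply: (le_trans (measure_bigcup_fin_le (mA m) (PA m))).
    have qm : q ^+ m = (2 ^+ m * ((9 / 10) ^+ m) ^+ 4)^-1.
      by rewrite /q exprVn exprMn -[in RHS]exprM mulnC exprM.
    rewrite lee_fin card_prod !card_ord natrM natrX qm /K /dyadic_tol.
    have u0 : 2 ^+ m != 0 :> R by rewrite expf_neq0.
    have v0 : (9 / 10) ^+ m != 0 :> R.
      by rewrite expf_neq0// gt_eqF//; lra.
    rewrite le_eqVlt; apply/orP; left; apply/eqP; field.
    by rewrite u0 v0 gt_eqF.
- move=> w nE i m k km; rewrite leNgt; apply/negP => lt.
  by apply: nE; exists m => //; exists (Ordinal km, i).
Qed.

(** * Moments of Brownian increments *)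

Section brownian_moments.
Context d (Omega : measurableType d) (R : realType) (P : probability Omega R).
Variables (N : nat) (B : R -> Omega -> 'rV[R]_N).
Hypothesis HB : brownian_motion P B.
Variable h : R.
Hypothesis h_gt0 : 0 < h.

(** [B 0 = 0] holds only almost surely; the increment has its law and independence directly from the
    definition of Brownian motion. *)
Let W (w : Omega) : 'rV[R]_N := B h w - B 0 w.

Let sqrth_gt0 : 0 < Num.sqrt h. Proof. by rewrite sqrtr_gt0. Qed.

Lemma measurable_brownian_increment i :
  measurable_fun setT (fun w => W w ord0 i).
Proof.
have mB t : 0 <= t -> measurable_fun setT (fun w => B t w ord0 i).
  move=> t0; exact: measurableT_comp (measurable_coord i) (bm_measurable HB t0).
rewrite (_ : (fun w => W w ord0 i) =
    (fun w => B h w ord0 i - B 0 w ord0 i)); last first.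
  by apply/funext => w; rewrite !mxE.
by apply: measurable_funB; apply: mB => //; exact: ltW.
Qed.

Lemma brownian_increment_law i (A : set R) : measurable A ->
  P ((fun w => W w ord0 i) @^-1` A) = normal_prob 0 (Num.sqrt h) A.
Proof.
move=> mA; rewrite -[X in Num.sqrt X]subr0.
rewrite -(@bm_gaussian _ _ _ _ _ _ HB i 0 h) ?lexx//.
by congr (P _); apply/seteqP; split => w /=; rewrite !mxE.
Qed.

Let mW := measurable_brownian_increment.
Let lawW := brownian_increment_law.

Lemma brownian_increment_fourth i : P.-integrable setT
    (fun w => (W w ord0 i ^+ 4)%:E) /\
  \int[P]_w (W w ord0 i ^+ 4) <= 32 * h ^+ 2.
Proof.
split; first exact: gaussian_fourth_integrable (mW i) (@lawW i).
have := gaussian_fourth_le sqrth_gt0 (mW i) (@lawW i).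
by rewrite (exprM (Num.sqrt h) 2 2) sqr_sqrtr// ltW.
Qed.

Lemma brownian_increment_mean i : P.-integrable setT
    (fun w => (W w ord0 i)%:E) /\ \int[P]_w (W w ord0 i) = 0.
Proof.
split; first exact: gaussian_integrable (mW i) (@lawW i).
exact: gaussian_mean (mW i) (@lawW i).
Qed.

Lemma brownian_increment_independent i j : i != j ->
  forall C D : set R, measurable C -> measurable D ->
  P ((fun w => W w ord0 i) @^-1` C `&` (fun w => W w ord0 j) @^-1` D) =
  (P ((fun w => W w ord0 i) @^-1` C) * P ((fun w => W w ord0 j) @^-1` D))%E.
Proof.
move=> ij C D mC mD.
(* One time step, from 0 to h. Coordinates other than i and j are given the full line, so their
   factors in the product rule are 1. *)
pose t k : R := if k is 0%N then 0 else h.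
pose A (k : 'I_1 * 'I_N) : set R :=
  if k.2 == i then C else if k.2 == j then D else setT.
have mA k : measurable (A k) by rewrite /A; case: ifP => // _; case: ifP.
have t0 : 0 <= t 0%N by [].
have tS k : t k <= t k.+1 by case: k => //=; exact: ltW.
have := @bm_independent _ _ _ _ _ _ HB 1 t t0 tS A mA.
set F := fun w => _.
rewrite (_ : [set w | _] = (fun w => W w ord0 i) @^-1` C `&`
    (fun w => W w ord0 j) @^-1` D); last first.
  apply/seteqP; split => w /=.
    move=> H; split.
      by have := H (ord0, i); rewrite /A/= eqxx !mxE.
    by have := H (ord0, j); rewrite /A/= eqxx eq_sym (negbTE ij) !mxE.
  move=> [WC WD] [[[|//] k0] m]; rewrite /A/=; case: eqP => [->|_].
    by move: WC; rewrite !mxE.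
  by case: eqP => [->|//]; move: WD; rewrite !mxE.
move=> ->.
have ij' : (ord0, j) != (ord0, i) :> 'I_1 * 'I_N.
  by rewrite xpair_eqE eqxx/= eq_sym.
rewrite (bigD1 (ord0, i))//= (bigD1 (ord0, j))//= big1 ?mule1; last first.
  move=> [k m] /andP[]; rewrite (ord1 k) !xpair_eqE !eqxx/= => mi mj.
  by rewrite /A/= (negbTE mi) (negbTE mj) preimage_setT probability_setT.
rewrite /A /= !eqxx eq_sym (negbTE ij).
by congr (P _ * P _)%E; apply/seteqP; split => w /=; rewrite !mxE.
Qed.

Lemma brownian_increment_cov i j : P.-integrable setT
    (fun w => (W w ord0 i * W w ord0 j)%:E) /\
  \int[P]_w (W w ord0 i * W w ord0 j) = (i == j)%:R * h.
Proof.
have iW2 k : P.-integrable setT (fun w => (W w ord0 k ^+ 2)%:E).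
  exact: gaussian_sqr_integrable (mW k) (@lawW k).
have iWW : P.-integrable setT (fun w => (W w ord0 i * W w ord0 j)%:E).
  apply: (@le_integrable _ _ _ P setT measurableT _
    (fun w => (W w ord0 i ^+ 2 + W w ord0 j ^+ 2)%:E)).
  - by apply/measurable_EFinP; exact: measurable_funM.
  - move=> w _; rewrite lee_fin [leRHS]ger0_norm ?addr_ge0 ?sqr_ge0//.
    set u := W w ord0 i; set v := W w ord0 j.
    have := sqr_ge0 (u + v); have := sqr_ge0 (u - v).
    by rewrite ler_norml => ? ?; apply/andP; split; nra.
  - by under eq_fun do rewrite EFinD; apply: integrableD.
split=> //; have [<-|ij] := eqVneq i j.
  rewrite mul1r; under eq_Rintegral do rewrite -expr2.
  by rewrite (gaussian_variance sqrth_gt0 (mW i) (@lawW i)) sqr_sqrtr// ltW.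
rewrite mul0r Rintegral_prod_independent//.
- by rewrite (brownian_increment_mean i).2 mul0r.
- exact: (brownian_increment_mean i).1.
- exact: (brownian_increment_mean j).1.
- exact: brownian_increment_independent.
Qed.

End brownian_moments.

Lemma Rintegral_sum d (T : measurableType d) (R : realType)
    (mu : {measure set T -> \bar R}) (I : Type) (r : seq I) (f : I -> T -> R) :
  (forall i, mu.-integrable setT (EFin \o f i)) ->
  mu.-integrable setT (fun w => (\sum_(i <- r) f i w)%:E) /\
  \int[mu]_w (\sum_(i <- r) f i w) = \sum_(i <- r) \int[mu]_w f i w.
Proof.
move=> fi; elim: r => [|i r [IHi IH]].
  under eq_fun do rewrite big_nil.
  split; first exact: integrable0.
  by under eq_Rintegral do rewrite big_nil;
    rewrite big_nil Rintegral_cst// mul0r.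
split.
  under eq_fun do rewrite big_cons EFinD.
  by apply: integrableD => //; exact: fi.
under eq_Rintegral do rewrite big_cons.
by rewrite RintegralD// big_cons IH.
Qed.

Lemma brownian_increment_dotp_sqr d (Omega : measurableType d) (R : realType)
    (P : probability Omega R) (N : nat) (B : R -> Omega -> 'rV[R]_N)
    (h : R) (z : 'rV[R]_N) : brownian_motion P B -> 0 < h ->
  P.-integrable setT (fun w => (dotp (B h w - B 0 w) z ^+ 2)%:E) /\
  \int[P]_w (dotp (B h w - B 0 w) z ^+ 2) = h * dotp z z.
Proof.
move=> HB h0.
pose g i j w := z ord0 i * z ord0 j *
  ((B h w - B 0 w) ord0 i * (B h w - B 0 w) ord0 j).
have gE w : dotp (B h w - B 0 w) z ^+ 2 = \sum_i \sum_j g i j w.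
  rewrite expr2 /dotp big_distrl/=; apply: eq_bigr => i _.
  by rewrite big_distrr/=; apply: eq_bigr => j _; rewrite /g; ring.
have gi i j : P.-integrable setT (EFin \o g i j).
  rewrite /comp/g; under eq_fun do rewrite EFinM.
  by apply: integrableZl => //; exact: (brownian_increment_cov HB h0 i j).1.
have gE1 i j : \int[P]_w g i j w = z ord0 i * z ord0 j * ((i == j)%:R * h).
  rewrite RintegralZl//; last exact: (brownian_increment_cov HB h0 i j).1.
  by rewrite (brownian_increment_cov HB h0 i j).2.
have gi1 i := (Rintegral_sum (index_enum 'I_N) (gi i)).1.
have [gi2 gE2] := Rintegral_sum (index_enum 'I_N) gi1.
split; first by under eq_fun do rewrite gE.
under eq_Rintegral do rewrite gE.
rewrite gE2 /dotp mulr_sumr; apply: eq_bigr => i _.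
rewrite (Rintegral_sum (index_enum 'I_N) (gi i)).2 (bigD1 i)//= big1.
  by rewrite gE1 eqxx mul1r addr0 mulrC.
by move=> j ji; rewrite gE1 eq_sym (negbTE ji) mul0r mulr0.
Qed.

(** * Integration against the transition density *)

Lemma measurable_dotpB (R : realType) N (x z : 'rV[R]_N) :
  measurable_fun setT (fun y : 'rV[R]_N => dotp (y - x) z).
Proof.
rewrite /dotp; apply: measurable_sum => i.
apply: measurable_funM => //.
under eq_fun do rewrite !mxE.
by apply: measurable_funB => //; exact: measurable_coord.
Qed.

Lemma enorm_ltE (R : realType) N (v : 'rV[R]_N) (r : R) : 0 < r ->
  (enorm v < r) = (dotp v v < r ^+ 2).
Proof.
move=> r0; rewrite /enorm -[X in _ < X](ger0_norm (ltW r0)) -sqrtr_sqr.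
by rewrite ltr_sqrt// exprn_gt0.
Qed.

Lemma measurable_eball (R : realType) N (x : 'rV[R]_N) (r : R) : 0 < r ->
  measurable (eball x r).
Proof.
move=> r0.
have mdot : measurable_fun setT (fun y : 'rV[R]_N => dotp (y - x) (y - x)).
  rewrite /dotp; apply: measurable_sum => i.
  under eq_fun do rewrite !mxE.
  by apply: measurable_funM; apply: measurable_funB => //;
    exact: measurable_coord.
rewrite [X in measurable X](_ : _ =
    (fun y => dotp (y - x) (y - x)) @^-1` `]-oo, r ^+ 2[); last first.
  by apply/seteqP; split => y /=; rewrite in_itv/= -enorm_ltE.
by rewrite -[X in measurable X]setTI; exact: mdot.
Qed.

Lemma measurable_chamber (R : realType) N (l : R) :
  measurable (@chamber R N l).
Proof.
have mlt (i j : 'I_N) (c : R) :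
    measurable [set y : 'rV[R]_N | y ord0 i < y ord0 j + c].
  rewrite [X in measurable X](_ : _ =
    (fun y : 'rV[R]_N => y ord0 i - y ord0 j) @^-1` `]-oo, c[); last first.
    by apply/seteqP; split => y /=; rewrite in_itv/= ltrBlDl.
  rewrite -[X in measurable X]setTI.
  have : measurable_fun setT (fun y : 'rV[R]_N => y ord0 i - y ord0 j).
    by apply: measurable_funB => //; exact: measurable_coord.
  by move=> mB; exact: mB.
rewrite [X in measurable X](_ : _ =
  \bigcap_(ij : 'I_N * 'I_N)
    [set y : 'rV[R]_N | (ij.1 < ij.2)%N -> y ord0 ij.1 < y ord0 ij.2 + 0] `&`
  \bigcap_(ij : 'I_N * 'I_N)
    [set y : 'rV[R]_N | (ij.1 == 0%N :> nat) && (ij.2 == N.-1 :> nat) ->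
       y ord0 ij.2 < y ord0 ij.1 + l]); last first.
  apply/seteqP; split => y.
    move=> [y1 y2]; split => -[i j] _ /=; first by rewrite addr0; exact: y1.
    by move=> /andP[/eqP i0 /eqP jN]; exact: y2.
  move=> [y1 y2]; split => i j.
    by have := y1 (i, j) I; rewrite /= addr0.
  by move=> /eqP i0 /eqP jN; have := y2 (i, j) I; rewrite /= i0 jN; exact.
apply: measurableI; apply: fin_bigcap_measurable; try exact: finite_finset.
  move=> [i j] _ /=; case: (i < j)%N.
    by rewrite [X in measurable X](_ : _ = [set y : 'rV[R]_N |
      y ord0 i < y ord0 j + 0])//; apply/seteqP; split => y //=; exact.
  by rewrite [X in measurable X](_ : _ = setT)//; apply/seteqP; split.
move=> [i j] _ /=; case: (_ && _).
  by rewrite [X in measurable X](_ : _ = [set y : 'rV[R]_N |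
    y ord0 j < y ord0 i + l])//; apply/seteqP; split => y //=; exact.
by rewrite [X in measurable X](_ : _ = setT)//; apply/seteqP; split.
Qed.

Section transition_density.
Context d (Omega : measurableType d) (R : realType) (P : probability Omega R).
Variables (N : nat) (l : R).
Let D : set 'rV[R]_N := chamber l.
Variables (X : 'rV[R]_N -> R -> Omega -> 'rV[R]_N).
Variables (p : 'rV[R]_N -> R -> 'rV[R]_N -> R).
Hypothesis Hp : transition_density P D X p.
Variables (x : 'rV[R]_N) (h : R) (A : set 'rV[R]_N) (f : 'rV[R]_N -> R).
Hypotheses (Dx : D x) (h0 : 0 < h).
Hypothesis mX : measurable_fun setT (X x h).
Hypotheses (mA : measurable A) (AD : A `<=` D).
Hypothesis mf : measurable_fun setT f.

(** On subsets of the chamber the law of [X x h] has density [p x h]; the indicator moves the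
    restriction to [A] into the integrand, so that pathwise estimates apply. *)
Lemma ge0_integral_transition_density :
  (forall y, A y -> 0 <= f y) ->
  (\int[lebesgue_rV N]_(y in A) (f y * p x h y)%:E =
   \int[P]_w (\1_A (X x h w) * f (X x h w))%:E)%E.
Proof.
move=> f0; have [mp p0 PA] := Hp Dx h0.
pose X' : {mfun Omega >-> 'rV[R]_N} :=
  HB.pack (X x h) (isMeasurableFun.Build _ _ _ _ _ mX).
rewrite -(@ge0_integral_density _ _ _ (distribution P X'))//; last 4 first.
- apply: (measurable_funS _ AD mp); exact: measurable_chamber.
- by move=> y /AD; exact: p0.
- by move=> E mE EA; apply: PA => //; exact: subset_trans EA AD.
- exact: measurable_funTS.
rewrite integral_mkcond.
rewrite (_ : (_ \_ _) = (fun y => (\1_A y * f y)%:E)); last first.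
  apply/funext => y; rewrite patchE indicE; case: ifPn => yA.
    by rewrite mul1r.
  by rewrite mul0r.
rewrite ge0_integral_distribution//.
  by apply/measurable_EFinP; exact: measurable_funM.
move=> y; rewrite lee_fin indicE; case: (boolP (y \in A)) => yA.
  by rewrite mul1r f0// -inE.
by rewrite mul0r.
Qed.

End transition_density.

Section transition_density_bounded.
Context d (Omega : measurableType d) (R : realType) (P : probability Omega R).
Variables (N : nat) (l : R).
Variables (X : 'rV[R]_N -> R -> Omega -> 'rV[R]_N).
Variables (p : 'rV[R]_N -> R -> 'rV[R]_N -> R).
Hypothesis Hp : transition_density P (chamber l) X p.
Variables (x : 'rV[R]_N) (h : R) (A : set 'rV[R]_N) (f : 'rV[R]_N -> R) (M : R).
Hypotheses (Dx : chamber l x) (h0 : 0 < h).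
Hypothesis mX : measurable_fun setT (X x h).
Hypotheses (mA : measurable A) (AD : A `<=` chamber l).
Hypothesis mf : measurable_fun setT f.
Hypothesis fM : forall y, A y -> `|f y| <= M.

(** When [A] is empty the bound [M] may be negative, whereas the shift below must be nonnegative. *)
Let M' := Num.max M 0.
Let M'0 : 0 <= M'. Proof. by rewrite le_max lexx orbT. Qed.
Let fM' y : A y -> `|f y| <= M'.
Proof. by move=> Ay; rewrite le_max fM. Qed.

Lemma integrable_indic_transition :
  P.-integrable setT (fun w => (\1_A (X x h w) * f (X x h w))%:E).
Proof.
apply: (@le_integrable _ _ _ P setT measurableT _ (fun w => M'%:E)).
- apply/measurable_EFinP; apply: measurable_funM.
    by apply: measurableT_comp => //; exact: measurable_indic.
  exact: measurableT_comp.
- move=> w _; rewrite lee_fin [leRHS]ger0_norm// indicE.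
  case: (boolP (_ \in _)); rewrite ?mul1r ?mul0r ?normr0// inE => ?.
  exact: fM'.
- exact: finite_measure_integrable_cst.
Qed.

(** A bounded f becomes nonnegative after adding M'. The nonnegative case applies to f + M' and to
    the constant M', and their difference is legitimate because M' p has finite integral over
    [A]. *)
Lemma Rintegral_transition_density :
  \int[lebesgue_rV N]_(y in A) (f y * p x h y) =
  \int[P]_w (\1_A (X x h w) * f (X x h w)).
Proof.
have [mp p0 PA] := Hp Dx h0.
have mpA : measurable_fun A (p x h).
  by apply: (measurable_funS _ AD mp); exact: measurable_chamber.
have cst_lty (k : R) : 0 <= k ->
    (\int[lebesgue_rV N]_(y in A) (k * p x h y)%:E < +oo)%E.
  move=> k0; rewrite (ge0_integral_transition_density Hp)//.
  apply: (@le_lt_trans _ _ (\int[P]_w (k%:E))%E).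
    apply: ge0_le_integral => //.
    - by move=> w _; rewrite lee_fin mulr_ge0.
    - apply/measurable_EFinP; apply: measurable_funM => //.
      by apply: measurableT_comp => //; exact: measurable_indic.
    - move=> w _; rewrite lee_fin indicE.
      by case: (_ \in _); rewrite ?mul1r ?mul0r.
  have ik : P.-integrable setT (fun=> k%:E).
    exact: finite_measure_integrable_cst.
  exact: integrable_lty ik.
have pge0 y : A y -> 0 <= p x h y by move/AD; exact: p0.
have i1 : (lebesgue_rV N).-integrable A (fun y => (M' * p x h y)%:E).
  apply/integrableP; split.
    by apply/measurable_EFinP; exact: measurable_funM.
  under eq_integral => y /[!inE] Ay.
    rewrite gee0_abs ?lee_fin ?mulr_ge0 ?pge0//; over.
  exact: cst_lty.
have i2 : (lebesgue_rV N).-integrable A (fun y => (f y * p x h y)%:E).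
  apply: le_integrable i1 => //.
    apply/measurable_EFinP; apply: measurable_funM => //.
    exact: measurable_funTS.
  move=> y Ay; rewrite lee_fin !normrM ler_wpM2r//.
  by rewrite (le_trans (fM' Ay))// ler_norm.
have iA (k : R) : P.-integrable setT (fun w => (\1_A (X x h w) * k)%:E).
  apply: (@le_integrable _ _ _ P setT measurableT _ (fun w => k%:E)).
  - apply/measurable_EFinP; apply: measurable_funM => //.
    by apply: measurableT_comp => //; exact: measurable_indic.
  - move=> w _; rewrite lee_fin indicE.
    by case: (_ \in _); rewrite ?mul1r ?mul0r ?normr0.
  - exact: finite_measure_integrable_cst.
have H1 : \int[lebesgue_rV N]_(y in A) ((f y + M') * p x h y) =
    \int[P]_w (\1_A (X x h w) * (f (X x h w) + M')).
  rewrite /Rintegral (ge0_integral_transition_density Hp)//.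
    exact: measurable_funD.
  move=> y /fM'; rewrite ler_norml => /andP[]; lra.
have H2 : \int[lebesgue_rV N]_(y in A) (M' * p x h y) =
    \int[P]_w (\1_A (X x h w) * M').
  by rewrite /Rintegral (ge0_integral_transition_density Hp).
apply: (@addIr _ (\int[lebesgue_rV N]_(y in A) (M' * p x h y))).
rewrite -RintegralD//; under eq_Rintegral do rewrite -mulrDl.
rewrite H1 H2 -RintegralD//; [|exact: integrable_indic_transition|exact: iA].
by apply: eq_Rintegral => w _; rewrite mulrDr.
Qed.

End transition_density_bounded.

(** * The drift *)

Section curve.
Variables (R : realType) (Gamma : set R[i]) (l : R) (gamma : R -> R[i]).
Hypothesis Hgamma : jordan_arclength Gamma l gamma.

Lemma jordan_periodic_int (t : R) (m : int) : gamma (t + m%:~R * l) = gamma t.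
Proof.
have per (n : nat) u : gamma (u + n%:R * l) = gamma u.
  elim: n => [|n IH]; first by rewrite mul0r addr0.
  by rewrite -natr1 mulrDl mul1r addrA (ja_periodic Hgamma).
case: m => n; first exact: per.
rewrite NegzE mulrNz mulNr -[in LHS](per n.+1) -pmulrn; congr gamma.
by rewrite subrK.
Qed.

(** Injectivity is given on [0, l) only. Shifting by the period that brings s into that interval
    leaves t in (0, 2 l), so one further period may have to be removed from t. *)
Lemma jordan_injective_lt (s t : R) : s < t -> t < s + l -> gamma s <> gamma t.
Proof.
move=> st tsl; have l0 := ja_length_gt0 Hgamma.
pose k := Num.floor (s / l).
rewrite -(jordan_periodic_int s (- k)) -(jordan_periodic_int t (- k)).
rewrite mulrNz mulNr.
have /andP[] := floor_itv (s / l); rewrite -/k intrD.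
rewrite ler_pdivlMr// ltr_pdivrMr// mulrDl mul1r.
set c := k%:~R * l => cs scl.
have [tl|tl] := ltP (t - c) l.
  move/(ja_injective Hgamma) => H.
  have : s - c = t - c by apply: H; lra.
  lra.
rewrite -(jordan_periodic_int (t - c) (-1)) mulrNz mulr1z mulN1r.
move/(ja_injective Hgamma) => H.
have : s - c = t - c - l by apply: H; lra.
lra.
Qed.

(** The squared chord is polynomial in the real and imaginary parts of [gamma], hence differentiable
    by real calculus alone. *)
Definition chord_sqr (s t : R) : R :=
  (complex.Re (gamma s) - complex.Re (gamma t)) ^+ 2 +
  (complex.Im (gamma s) - complex.Im (gamma t)) ^+ 2.

Lemma normcB_sqrt (s t : R) :
  Normc.normc (gamma s - gamma t) = Num.sqrt (chord_sqr s t).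
Proof. by rewrite /chord_sqr; case: (gamma s) => ? ?; case: (gamma t). Qed.

Lemma chord_sqr_gt0 (N : nat) (y : 'rV[R]_N) (i j : 'I_N) :
  chamber l y -> i != j -> 0 < chord_sqr (y ord0 i) (y ord0 j).
Proof.
have sym s t : chord_sqr s t = chord_sqr t s by rewrite /chord_sqr; ring.
move=> [y1 y2].
wlog ij : i j / (i < j)%N => [wl|].
  move=> nij; have /orP[ij|ji] : (i < j)%N || (j < i)%N.
    by rewrite -neq_ltn.
    exact: wl.
  by rewrite sym; apply: wl; rewrite // eq_sym.
move=> _; have N0 : (0 < N)%N by apply: leq_ltn_trans (ltn_ord i).
have yij := y1 _ _ ij.
(* The chamber compares only the extreme particles across a period; monotonicity passes the bound on
   to every pair. *)
have yl : y ord0 j < y ord0 i + l.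
  have jN : (N.-1 < N)%N by rewrite prednK.
  have := y2 (Ordinal N0) (Ordinal jN) erefl erefl.
  have le_ord (u v : 'I_N) : (u <= v)%N -> y ord0 u <= y ord0 v.
    rewrite leq_eqVlt => /orP[/eqP/val_inj ->//|uv]; exact/ltW/y1.
  have := le_ord (Ordinal N0) i (leq0n _).
  have : (j <= N.-1)%N by rewrite -ltnS prednK.
  move=> /(le_ord j (Ordinal jN)); lra.
have := @jordan_injective_lt _ _ yij yl.
rewrite lt_neqAle addr_ge0 ?sqr_ge0// andbT eq_sym => gij.
apply/negP; rewrite paddr_eq0 ?sqr_ge0// !sqrf_eq0 !subr_eq0.
move=> /andP[/eqP Re_eq /eqP Im_eq]; apply: gij.
by apply/eqP; rewrite eq_complex Re_eq Im_eq !eqxx.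
Qed.

(** The exponent beta / 2 of the chord becomes beta / 4 on its square. Positivity of the chords in
    the chamber allows the logarithm to be split. *)
Lemma ln_rhoE (N : nat) (c beta : R) (y : 'rV[R]_N) : 0 < c -> chamber l y ->
  ln (rho c beta gamma y) = ln c + \sum_(i < N) \sum_(j < N | j != i)
    beta / 4 * ln (chord_sqr (y ord0 i) (y ord0 j)).
Proof.
move=> c0 Dy.
have ln_prod_pos (I : Type) (r : seq I) (Q : pred I) (F : I -> R) :
    (forall i, Q i -> 0 < F i) -> 0 < \prod_(i <- r | Q i) F i /\
    ln (\prod_(i <- r | Q i) F i) = \sum_(i <- r | Q i) ln (F i).
  move=> F0; elim: r => [|i r [IH0 IH]]; first by rewrite !big_nil ln1.
  rewrite !big_cons; case: ifPn => // Qi; split; first by rewrite mulr_gt0// F0.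
  by rewrite lnM ?posrE ?F0// IH.
have n0 i j : j != i ->
    0 < Normc.normc (gamma (y ord0 i) - gamma (y ord0 j)) `^ (beta / 2).
  by move=> ji; rewrite powR_gt0// normcB_sqrt sqrtr_gt0 chord_sqr_gt0// eq_sym.
have inner i := @ln_prod_pos _ (index_enum 'I_N) (fun j => j != i) _ (n0 i).
have [out0 outE] := @ln_prod_pos _ (index_enum 'I_N) xpredT _
  (fun i _ => (inner i).1).
rewrite /rho lnM ?posrE// outE; congr (_ + _); apply: eq_bigr => i _.
rewrite (inner i).2; apply: eq_bigr => j ji.
have q0 : 0 < chord_sqr (y ord0 i) (y ord0 j) by rewrite chord_sqr_gt0// eq_sym.
rewrite ln_powR normcB_sqrt -[in RHS](sqr_sqrtr (ltW q0)) lnXn ?sqrtr_gt0//.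
by field.
Qed.

End curve.

(** The explicit formula for log rho holds on the chamber only; openness lets it be differentiated
    there. *)
Lemma chamber_open (R : realType) (N : nat) (l : R) (x : 'rV[R]_N) :
  chamber l x -> \forall y \near x, chamber l y.
Proof.
move=> [x1 x2].
have lt_near (i j : 'I_N) (c : R) : x ord0 i < x ord0 j + c ->
    \forall y \near x, (y : 'rV[R]_N) ord0 i < y ord0 j + c.
  move=> xij.
  have ci : (y : 'rV[R]_N) ord0 i - y ord0 j @[y --> x] --> x ord0 i - x ord0 j.
    apply: (@cvgB _ R^o _ _ _ (fun y : 'rV[R]_N => y ord0 i)
      (fun y : 'rV[R]_N => y ord0 j)).
    - exact: (@nbhs_filter _ x).
    - exact: (@coord_continuous R 1 N ord0 i x).
    - exact: (@coord_continuous R 1 N ord0 j x).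
  have /(cvgr_lt (x ord0 i - x ord0 j)) : x ord0 i - x ord0 j < c by lra.
  move=> /(_ _ _ _ _ ci); apply: filterS => y; lra.
have all_near (Q : 'I_N -> 'I_N -> 'rV[R]_N -> Prop) :
    (forall i j, \forall y \near x, Q i j y) ->
    \forall y \near x, forall i j, Q i j y.
  move=> H; have FF := nbhs_filter x.
  apply: (@filter_forall _ _ _ _ FF) => i.
  by apply: (@filter_forall _ _ _ _ FF) => j; exact: H.
have H1 : \forall y \near x, forall i j : 'I_N,
    (i < j)%N -> (y : 'rV[R]_N) ord0 i < y ord0 j.
  apply: all_near => i j; have [ij|ij] := boolP (i < j)%N; last first.
    by apply: (@filterE _ _ (nbhs_filter x)) => y.
  have : x ord0 i < x ord0 j + 0 by rewrite addr0 x1.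
  by move/lt_near; apply: filterS => y; rewrite addr0.
have H2 : \forall y \near x, forall i j : 'I_N,
    (i == 0%N :> nat) && (j == N.-1 :> nat) ->
    (y : 'rV[R]_N) ord0 j < y ord0 i + l.
  apply: all_near => i j.
  have [ij|ij] := boolP ((i == 0%N :> nat) && (j == N.-1 :> nat));
    last first.
    by apply: (@filterE _ _ (nbhs_filter x)) => y.
  move: ij => /andP[/eqP i0 /eqP jN].
  by have /lt_near := x2 _ _ i0 jN; apply: filterS.
apply: filterS2 H1 H2 => y y1 y2; split => // i j /eqP i0 /eqP jN.
by apply: y2; rewrite i0 jN.
Qed.

Section directional_derivative.
Variables (R : realType) (V : normedModType R).
Implicit Types (f : V -> R) (x v : V).

(** Restricting to the line through x in direction v turns a directional derivative into an ordinary
    one, so the one-variable chain rule applies. *)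
Lemma is_derive_line f x v df :
  is_derive x v f df <-> is_derive (0 : R) 1 (fun h : R => f (h *: v + x)) df.
Proof.
have E : (fun h : R => h^-1 *: ((f \o shift x) (h *: v) - f x)) =
    (fun h : R => h^-1 *:
       (((fun k : R => f (k *: v + x)) \o shift 0) (h *: (1 : R)) -
       (fun k : R => f (k *: v + x)) 0)).
  apply/funext => h /=; rewrite scale0r add0r addr0; congr (_ *: (f _ - _)).
  by rewrite [h *: 1]mulr1.
by split=> -[dx <-]; split; rewrite /derivable/derive ?E// -?E.
Qed.

Lemma is_derive_comp_line (phi : R -> R) f x v a b :
  is_derive (f x) 1 phi a -> is_derive x v f b ->
  is_derive x v (phi \o f) (a * b).
Proof.
move=> dphi /is_derive_line df; apply/is_derive_line.
apply: (@is_derive1_comp _ phi (fun h : R => f (h *: v + x))) => //.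
by rewrite scale0r add0r.
Qed.

Lemma is_derive_bigsum (I : Type) (r : seq I) (Q : pred I) (F : I -> V -> R)
    (dF : I -> R) x v :
  (forall i, Q i -> is_derive x v (F i) (dF i)) ->
  is_derive x v (fun y => \sum_(i <- r | Q i) F i y) (\sum_(i <- r | Q i) dF i).
Proof.
move=> H; elim: r => [|i r IH].
  rewrite big_nil (_ : (fun _ => _) = cst 0); first exact: is_derive_cst.
  by apply/funext => y; rewrite big_nil.
rewrite big_cons; case: ifPn => Qi; last first.
  rewrite (_ : (fun _ => _) = (fun y => \sum_(j <- r | Q j) F j y))//.
  by apply/funext => y; rewrite big_cons (negbTE Qi).
rewrite (_ : (fun _ => _) = F i + (fun y => \sum_(j <- r | Q j) F j y)).
  by apply: is_deriveD; exact: H.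
by apply/funext => y; rewrite big_cons Qi.
Qed.

End directional_derivative.

Section drift_formula.
Variables (R : realType) (Gamma : set R[i]) (l : R) (gamma : R -> R[i]).
Hypothesis Hgamma : jordan_arclength Gamma l gamma.
Variable N : nat.
Implicit Types (y : 'rV[R]_N) (i j k : 'I_N).

Let a (t : R) := complex.Re (gamma t).
Let b (t : R) := complex.Im (gamma t).

Lemma is_derive_coord y k i :
  is_derive y (delta_mx ord0 k) (fun z : 'rV[R]_N => z ord0 i) (i == k)%:R.
Proof.
apply/is_derive_line.
rewrite (_ : (fun _ => _) = (fun h : R => (i == k)%:R * h + y ord0 i)).
  by apply: is_derive_eq; rewrite addr0 [_ *: 1]mulr1.
by apply/funext => h; rewrite !mxE eqxx mulrC.
Qed.

Let is_derive_C2 (f : R -> R) (t : R) : C2_fun f ->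
  is_derive t (1 : R) f (f^`()%classic t).
Proof. by move=> [df _ _]; rewrite derive1E; apply: derivableP. Qed.

Definition chord_sqr_grad k i j y : R :=
  2 * (a (y ord0 i) - a (y ord0 j)) *
    (a^`()%classic (y ord0 i) * (i == k)%:R -
     a^`()%classic (y ord0 j) * (j == k)%:R) +
  2 * (b (y ord0 i) - b (y ord0 j)) *
    (b^`()%classic (y ord0 i) * (i == k)%:R -
     b^`()%classic (y ord0 j) * (j == k)%:R).

Lemma is_derive_chord_sqr k i j y : is_derive y (delta_mx ord0 k)
  (fun z : 'rV[R]_N => chord_sqr gamma (z ord0 i) (z ord0 j))
  (chord_sqr_grad k i j y).
Proof.
have [Ca Cb] := ja_C2 Hgamma.
have da f m : C2_fun f -> is_derive y (delta_mx ord0 k)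
    (fun z : 'rV[R]_N => f (z ord0 m)) (f^`()%classic (y ord0 m) * (m == k)%:R).
  move=> Cf; apply: is_derive_comp_line; last exact: is_derive_coord.
  exact: is_derive_C2.
have dai := da _ i Ca; have daj := da _ j Ca.
have dbi := da _ i Cb; have dbj := da _ j Cb.
rewrite (_ : (fun _ => _) =
  ((fun z : 'rV[R]_N => a (z ord0 i)) - (fun z : 'rV[R]_N => a (z ord0 j))) ^+ 2
  + ((fun z : 'rV[R]_N => b (z ord0 i)) -
     (fun z : 'rV[R]_N => b (z ord0 j))) ^+ 2); last first.
  by apply/funext => z.
apply: is_derive_eq.
rewrite /chord_sqr_grad /GRing.scale/= !fctE /a /b; ring.
Qed.

Definition log_rho_grad (beta : R) k y : R :=
  \sum_(i < N) \sum_(j < N | j != i) beta / 4 *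
    ((chord_sqr gamma (y ord0 i) (y ord0 j))^-1 * chord_sqr_grad k i j y).

Lemma driftE (c beta : R) y k : 0 < c -> chamber l y ->
  drift c beta gamma y ord0 k = 2^-1 * log_rho_grad beta k y.
Proof.
move=> c0 Dy; rewrite /drift /grad !mxE; congr (_ * _).
rewrite (@near_eq_derive _ _ _ _ (fun z : 'rV[R]_N => ln c +
    \sum_(i < N) \sum_(j < N | j != i)
    beta / 4 * ln (chord_sqr gamma (z ord0 i) (z ord0 j)))); last first.
  by apply: filterS (chamber_open Dy) => z; exact: (ln_rhoE Hgamma).
suff H : is_derive y (delta_mx ord0 k)
    (cst (ln c) + (fun z : 'rV[R]_N => \sum_(i < N) \sum_(j < N | j != i)
    beta / 4 * ln (chord_sqr gamma (z ord0 i) (z ord0 j))))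
    (0 + log_rho_grad beta k y).
  by rewrite -[log_rho_grad _ _ _]add0r; exact: derive_val.
apply: is_deriveD.
apply: is_derive_bigsum => i _; apply: is_derive_bigsum => j ji.
apply: (@is_deriveZ _ _ _
  (fun z : 'rV[R]_N => ln (chord_sqr gamma (z ord0 i) (z ord0 j)))).
apply: is_derive_comp_line; last exact: is_derive_chord_sqr.
apply: is_derive1_ln; apply: (chord_sqr_gt0 Hgamma Dy).
by rewrite eq_sym.
Qed.

End drift_formula.

Lemma cvg_sumr (R : realType) (T : Type) (F : set_system T) (I : Type)
    (r : seq I) (Q : pred I) (f : I -> T -> R) (g : I -> R) : Filter F ->
  (forall i, Q i -> f i x @[x --> F] --> g i) ->
  \sum_(i <- r | Q i) f i x @[x --> F] --> \sum_(i <- r | Q i) g i.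
Proof.
move=> FF fg; elim: r => [|i r IH].
  by rewrite big_nil; under eq_cvg do rewrite big_nil; exact: cvg_cst.
rewrite big_cons; under eq_cvg do rewrite big_cons.
case: ifPn => // Qi.
by apply: (@cvgD _ R^o) => //; exact: fg.
Qed.

(** Continuity of one summand of [log_rho_grad], seen as a function of eight reals: u, v are the
    real parts and w, z the imaginary parts of [gamma] at two particles, primes are their
    derivatives, and c1, c2 stand for Kronecker deltas. *)
Lemma cvg_chord_term (R : realType) (T : Type) (F : set_system T)
    (u v u' v' w z w' z' : T -> R) (U V U' V' W Z W' Z' k c1 c2 : R) :
  Filter F -> (U - V) ^+ 2 + (W - Z) ^+ 2 != 0 ->
  u @ F --> U -> v @ F --> V -> u' @ F --> U' -> v' @ F --> V' ->
  w @ F --> W -> z @ F --> Z -> w' @ F --> W' -> z' @ F --> Z' ->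
  k * (((u t - v t) ^+ 2 + (w t - z t) ^+ 2)^-1 *
    (2 * (u t - v t) * (u' t * c1 - v' t * c2) +
     2 * (w t - z t) * (w' t * c1 - z' t * c2))) @[t --> F] -->
  k * (((U - V) ^+ 2 + (W - Z) ^+ 2)^-1 *
    (2 * (U - V) * (U' * c1 - V' * c2) + 2 * (W - Z) * (W' * c1 - Z' * c2))).
Proof.
move=> FF n0 uU vV uU' vV' wW zZ wW' zZ'.
have uv : u t - v t @[t --> F] --> U - V by exact: (@cvgB _ R^o).
have wz : w t - z t @[t --> F] --> W - Z by exact: (@cvgB _ R^o).
have sq (f : T -> R) (L : R) : f @ F --> L -> f t ^+ 2 @[t --> F] --> L ^+ 2.
  by move=> fL; apply: (cvg_comp f (fun r : R => r ^+ 2) fL);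
    exact: exprn_continuous.
have lin (f g f' g' : T -> R) (L M L' M' : R) :
    f t - g t @[t --> F] --> L - M -> f' @ F --> L' -> g' @ F --> M' ->
    2 * (f t - g t) * (f' t * c1 - g' t * c2) @[t --> F] -->
    2 * (L - M) * (L' * c1 - M' * c2).
  move=> fg fL gM; apply: cvgM.
    by apply: cvgM => //; exact: cvg_cst.
  by apply: (@cvgB _ R^o); apply: cvgM => //; exact: cvg_cst.
apply: cvgM; first exact: cvg_cst.
apply: cvgM.
  by apply: cvgV => //; apply: (@cvgD _ R^o); exact: sq.
by apply: (@cvgD _ R^o); exact: lin.
Qed.

Section drift_continuity.
Variables (R : realType) (Gamma : set R[i]) (l : R) (gamma : R -> R[i]).
Hypothesis Hgamma : jordan_arclength Gamma l gamma.
Variable N : nat.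
Implicit Types (y : 'rV[R]_N) (i j k : 'I_N).

Let a (t : R) := complex.Re (gamma t).
Let b (t : R) := complex.Im (gamma t).

Lemma log_rho_grad_continuous beta k x : chamber l x ->
  {for x, continuous (log_rho_grad gamma beta k)}.
Proof.
move=> Dx.
have FF := nbhs_filter x.
have [Ca Cb] := ja_C2 Hgamma.
have cont (f : R -> R) : (forall t, derivable f t 1) -> continuous f.
  by move=> df t; apply: differentiable_continuous; apply/derivable1_diffP.
have coord i : (y : 'rV[R]_N) ord0 i @[y --> x] --> x ord0 i.
  exact: (@coord_continuous R 1 N ord0 i x).
have cc (f : R -> R) i : continuous f ->
    f ((y : 'rV[R]_N) ord0 i) @[y --> x] --> f (x ord0 i).
  by move=> cf; apply: (cvg_comp _ f (coord i)); exact: cf.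
have [Da D2a _] := Ca; have [Db D2b _] := Cb.
have ca i := cc _ i (cont _ Da); have cb i := cc _ i (cont _ Db).
have ca' i := cc _ i (cont _ D2a); have cb' i := cc _ i (cont _ D2b).
change (log_rho_grad gamma beta k y @[y --> x] --> log_rho_grad gamma beta k x).
rewrite /log_rho_grad.
apply: (cvg_sumr FF) => i _.
apply: (cvg_sumr FF) => j ji.
have n0 : (a (x ord0 i) - a (x ord0 j)) ^+ 2 +
    (b (x ord0 i) - b (x ord0 j)) ^+ 2 != 0.
  by rewrite gt_eqF//; apply: (chord_sqr_gt0 Hgamma Dx); rewrite eq_sym.
exact: (cvg_chord_term FF n0 (ca i) (ca j) (ca' i) (ca' j)
  (cb i) (cb j) (cb' i) (cb' j)).
Qed.

Lemma drift_near (c beta e : R) (x : 'rV[R]_N) : 0 < c -> 0 < e ->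
  chamber l x -> exists2 r : R, 0 < r & forall y : 'rV[R]_N,
    (forall i, `|y ord0 i - x ord0 i| < r) -> forall i,
    `|drift c beta gamma y ord0 i - drift c beta gamma x ord0 i| <= e.
Proof.
move=> c0 e0 Dx.
have FF := nbhs_filter x.
have H i : \forall y \near x,
    `|log_rho_grad gamma beta i y - log_rho_grad gamma beta i x| < e.
  have := log_rho_grad_continuous (beta := beta) (k := i) Dx.
  by move=> /cvgrPdist_lt /(_ _ e0); apply: filterS => y; rewrite distrC.
(* The neighbourhood is shrunk into the chamber, where [driftE] is valid. *)
have {}H : \forall y \near x, chamber l y /\ forall i,
    `|log_rho_grad gamma beta i y - log_rho_grad gamma beta i x| < e.
  apply: (@filterI _ _ FF); first exact: chamber_open.
  exact: (@filter_forall _ _ _ _ FF).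
have /nbhs_ballP[r /= r0 rH] := H.
exists r => // y yr i.
have [Dy /(_ i) ei] : chamber l y /\ forall i,
    `|log_rho_grad gamma beta i y - log_rho_grad gamma beta i x| < e.
  apply: rH; split => // m n; rewrite (ord1 m) /ball/= distrC; exact: yr.
have half (u v gu gv : R) : u = 2^-1 * gu -> v = 2^-1 * gv ->
    `|gu - gv| < e -> `|u - v| <= e.
  move=> -> ->; rewrite -mulrBr normrM ger0_norm ?invr_ge0//.
  by have := normr_ge0 (gu - gv); lra.
exact: half (driftE Hgamma beta i c0 Dy) (driftE Hgamma beta i c0 Dx) ei.
Qed.

End drift_continuity.

(** * Pathwise estimates *)

(** Closeness is assumed strictly before t only, the endpoint being a null set. This is what a
    first-exit argument can supply: at the exit time itself nothing is known yet. *)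
Lemma Rintegral_near_cst (R : realType) (f : R -> R) (c e t : R) : 0 <= t ->
  lebesgue_measure.-integrable `[0, t] (EFin \o f) ->
  (forall s : R, 0 <= s < t -> `|f s - c| <= e) ->
  `|\int[lebesgue_measure]_(s in `[0, t]) f s - t * c| <= t * e.
Proof.
move=> t0 fi fe.
have mt : fine (@lebesgue_measure R `[0, t[) = t.
  rewrite lebesgue_measure_itv/= lte_fin.
  have [t0'|t0'] := ltP 0 t; first by rewrite oppr0 adde0.
  by apply/eqP; rewrite eq_le t0 t0'.
have fi' : lebesgue_measure.-integrable `[0, t[ (EFin \o f).
  by apply: integrableS fi => //; apply: subset_itvl; rewrite bnd_simp.
have ci (k : R) : (@lebesgue_measure R).-integrable `[0, t[ (EFin \o cst k).
  apply/integrableP; split; first exact/measurable_EFinP.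
  rewrite (eq_integral (cst `|k|%:E))// integral_cst//= lebesgue_measure_itv/=.
  by case: ifP => _; rewrite ?mule0 ?ltry// -EFinD -EFinM ltry.
rewrite -Rintegral_itv_bndo_bndc//.
have -> : t * c = \int[lebesgue_measure]_(s in `[0, t[) c.
  by rewrite Rintegral_cst// mt mulrC.
have -> : t * e = \int[lebesgue_measure]_(s in `[0, t[) e.
  by rewrite Rintegral_cst// mt mulrC.
rewrite -RintegralB//.
have fci : lebesgue_measure.-integrable `[0, t[ (EFin \o (fun s => f s - c)).
  exact: (integrableB _ fi' (ci c)).
apply: le_trans (le_normr_Rintegral _ fci) _ => //.
apply: le_Rintegral => //.
- exact: integrable_norm.
- exact: ci.
exact: ci.
Qed.

Section path_estimate.
Variables (R : realType) (N : nat) (b : 'rV[R]_N -> 'rV[R]_N).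
Variables (x : 'rV[R]_N) (r e M h : R) (X B : R -> 'rV[R]_N).
Hypothesis e_ge0 : 0 <= e.
Hypothesis b_near : forall y : 'rV[R]_N,
  (forall i, `|y ord0 i - x ord0 i| < r) ->
  forall i, `|b y ord0 i - b x ord0 i| <= e.
Hypothesis bM : forall i, `|b x ord0 i| + e <= M.
Hypothesis h_ge0 : 0 <= h.
Hypothesis hM : h * M < r / 2.
Hypothesis X_cont : forall s : R, 0 <= s -> forall e' : R, 0 < e' ->
  exists2 k : R, 0 < k & forall t : R, 0 <= t -> `|t - s| < k ->
    forall i, `|X t ord0 i - X s ord0 i| < e'.
Hypothesis X_int : forall t : R, 0 <= t -> forall i,
  lebesgue_measure.-integrable `[0, t] (fun s => (b (X s) ord0 i)%:E).
Hypothesis X_eq : forall t : R, 0 <= t -> X t = x + B t +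
  \row_(i < N) \int[lebesgue_measure]_(s in `[0, t]) b (X s) ord0 i.
Hypothesis B_small : forall t : R, 0 <= t <= h ->
  forall i, `|B t ord0 i| <= r / 2.

(** If the path stays in the cube before t, the expansion holds at t and the displacement there is
    at most r/2 from the Brownian part plus h M < r/2 from the drift. The strict inequality keeps
    the path inside at t as well. *)
Let step (t : R) : 0 <= t <= h ->
  (forall s : R, 0 <= s < t -> forall i, `|X s ord0 i - x ord0 i| < r) ->
  forall i, `|X t ord0 i - x ord0 i - B t ord0 i - t * b x ord0 i| <= t * e /\
    `|X t ord0 i - x ord0 i| < r.
Proof.
move=> /andP[t0 th] Xs i.
have Ebd : `|X t ord0 i - x ord0 i - B t ord0 i - t * b x ord0 i| <= t * e.
  rewrite {1}X_eq// !mxE.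
  rewrite (_ : _ - _ - _ - _ = \int[lebesgue_measure]_(s in `[0, t])
    b (X s) ord0 i - t * b x ord0 i); last by ring.
  apply: Rintegral_near_cst => //; first exact: X_int.
  by move=> s st; apply: b_near; exact: Xs.
split => //.
have tB : `|B t ord0 i| <= r / 2 by apply: B_small; rewrite t0.
have M0 : 0 <= M by apply: le_trans (bM i); rewrite addr_ge0.
have tM : t * (`|b x ord0 i| + e) <= h * M.
  apply: (@le_trans _ _ (t * M)); first by rewrite ler_wpM2l.
  exact: ler_wpM2r.
have aux (p q k u v s' : R) : p <= k * u -> k * (v + u) <= q -> q < r / 2 ->
    s' <= r / 2 -> p + k * v + s' < r by lra.
move: Ebd tM; set u := X t ord0 i - x ord0 i - B t ord0 i - _ => Ebd tM.
have -> : X t ord0 i - x ord0 i = u + t * b x ord0 i + B t ord0 i.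
  by rewrite /u; ring.
apply: le_lt_trans (ler_normD _ _) _.
apply: le_lt_trans (lerD (ler_normD _ _) (lexx _)) _.
rewrite (normrM t) (ger0_norm t0); exact: aux Ebd tM hM tB.
Qed.

Lemma path_in_ball : 0 < r -> forall t : R, 0 <= t <= h ->
  forall i, `|X t ord0 i - x ord0 i| < r.
Proof.
move=> r0 t1 ht1 i1; rewrite ltNge; apply/negP => ri1.
(* The exit times up to h; their infimum tau is the first one, and [step] shows that the path is
   still strictly inside at tau. *)
pose S := [set t | 0 <= t <= h /\ exists i, r <= `|X t ord0 i - x ord0 i|].
have S0 : S !=set0 by exists t1; split => //; exists i1.
have lbS : lbound S 0 by move=> t [/andP[]].
have hS : has_inf S by split => //; exists 0.
pose tau := inf S.
have tau0 : 0 <= tau by exact: lb_le_inf.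
have tauh : tau <= h.
  have [t St] := S0; have := ge_inf (hS.2) St.
  by case: St => /andP[_ th] _ /le_trans; apply.
have before (s : R) : 0 <= s < tau -> forall i, `|X s ord0 i - x ord0 i| < r.
  move=> /andP[s0 st] i; rewrite ltNge; apply/negP => rs.
  have Ss : S s.
    by split; [rewrite s0 (ltW (lt_le_trans st tauh))|exists i].
  by have := ge_inf hS.2 Ss; rewrite leNgt st.
have th : 0 <= tau <= h by rewrite tau0.
have at_tau i := (step th before i).2.
(* The least distance to the boundary at tau over all coordinates. Continuity at scale g keeps the
   path inside for a while after tau, against the choice of tau as an infimum. *)
pose g := \big[Num.min/r]_i (r - `|X tau ord0 i - x ord0 i|).
have g0 : 0 < g.
  rewrite /g; elim/big_ind : _ => // [u v u0 v0|i _].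
    by rewrite lt_min u0.
  by rewrite subr_gt0.
have gle i : g <= r - `|X tau ord0 i - x ord0 i| by exact: bigmin_le_cond.
have [k k0 kP] := X_cont tau0 g0.
have /(inf_adherent k0)[t [/andP[t0 _] [i ri]] ttau] := hS.
have taut : tau <= t.
  rewrite leNgt; apply/negP => tlt.
  by have := before t _ i; rewrite t0 => /(_ tlt); rewrite ltNge ri.
have := kP t t0; rewrite ger0_norm ?subr_ge0// ltrBlDl => /(_ ttau i).
have := gle i.
have := ler_normD (X t ord0 i - X tau ord0 i) (X tau ord0 i - x ord0 i).
rewrite addrA subrK; lra.
Qed.

Lemma path_increment : 0 < r ->
  forall i, `|X h ord0 i - x ord0 i - B h ord0 i - h * b x ord0 i| <= h * e.
Proof.
move=> r0 i; have hh : 0 <= h <= h by rewrite h_ge0 lexx.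
apply: (step hh _ i).1 => s /andP[s0 sh] j.
by apply: path_in_ball => //; rewrite s0 ltW.
Qed.

End path_estimate.

(** K may depend on e because the limit in h is taken with e fixed: once h < e / (2 (K + 1)), the
    quadratic error is absorbed by half of the tolerance. *)
Lemma rescaled_limit (R : realType) (f : R -> R) (L : R) :
  (forall e, 0 < e -> exists K h0, [/\ 0 <= K, 0 < h0 & forall h, 0 < h < h0 ->
    `|f h - h * L| <= h * e + K * h ^+ 2]) ->
  h^-1 * f h @[h --> 0^'+] --> L.
Proof.
move=> H; apply/cvgrPdist_le => e e0.
have [|K [h0 [K0 h00 Hf]]] := H (e / 2); first by rewrite divr_gt0.
have m0 : 0 < Num.min h0 (e / (2 * (K + 1))).
  by rewrite lt_min h00 divr_gt0// mulr_gt0// ltr_wpDl.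
near=> h.
have hgt : 0 < h by near: h; exact: nbhs_right_gt.
have : h < Num.min h0 (e / (2 * (K + 1))) by near: h; exact: nbhs_right_lt.
rewrite lt_min => /andP[hh0]; rewrite ltr_pdivlMr ?mulr_gt0 ?ltr_wpDl// => hK.
have /Hf Hh : 0 < h < h0 by rewrite hgt.
rewrite (_ : L - _ = - (h^-1 * (f h - h * L))); last first.
  by field; rewrite gt_eqF.
rewrite normrN normrM gtr0_norm ?invr_gt0// mulrC ler_pdivrMr//.
apply: le_trans Hh _; nra.
Unshelve. all: by end_near. Qed.

(** Each limit is reached through a majorant V with explicitly bounded integral. The comparison is
    almost sure because the equation for X is. *)
Lemma normr_Rintegral_le_ae d (T : measurableType d) (R : realType)
    (mu : {measure set T -> \bar R}) (U V : T -> R) :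
  mu.-integrable setT (EFin \o U) -> mu.-integrable setT (EFin \o V) ->
  (forall w, 0 <= V w) -> {ae mu, forall w, `|U w| <= V w} ->
  `|\int[mu]_w U w| <= \int[mu]_w V w.
Proof.
move=> iU iV V0 UV.
apply: le_trans (le_normr_Rintegral measurableT iU) _.
have iU' : mu.-integrable setT (EFin \o (fun w => `|U w|)).
  exact: integrable_norm.
rewrite -lee_fin /Rintegral !fineK; last 2 first.
- exact: integrable_fin_num iV.
- exact: integrable_fin_num iU'.
apply: ae_ge0_le_integral => //.
- exact: measurable_int iU'.
- by move=> w _; rewrite lee_fin.
- exact: measurable_int iV.
- by apply: filterS UV => w UVw _; rewrite lee_fin.
Qed.

Lemma continuous_path_coord (R : realType) (N : nat) (F : R -> 'rV[R]_N) :
  {within `[0, +oo[%classic, continuous F} ->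
  forall s : R, 0 <= s -> forall e : R, 0 < e ->
  exists2 k : R, 0 < k & forall t : R, 0 <= t -> `|t - s| < k ->
    forall i, `|F t ord0 i - F s ord0 i| < e.
Proof.
move=> /subspace_continuousP cF s s0 e e0.
have /cF : `[0, +oo[%classic s by rewrite /= in_itv/= s0.
move=> /(_ (ball (F s) e)) []; first exact: nbhsx_ballx.
move=> k /= k0 kP; exists k => // t t0 ts i.
have [] := kP t.
- by rewrite /ball/= distrC.
- by rewrite /= in_itv/= t0.
by move=> _ /(_ ord0 i); rewrite /ball/= distrC.
Qed.

Lemma eball_coord (R : realType) (N : nat) (x y : 'rV[R]_N) (delta : R) i :
  0 < delta -> eball x delta y -> `|y ord0 i - x ord0 i| < delta.
Proof.
move=> d0; rewrite /eball /= enorm_ltE// => H.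
rewrite -(ltr_pXn2r (n := 2))// ?nnegrE ?(ltW d0)// real_normK ?num_real//.
apply: le_lt_trans H; rewrite /dotp (bigD1 i)//= !mxE -expr2 lerDl.
by apply: sumr_ge0 => j _; rewrite -expr2 sqr_ge0.
Qed.

(** From the coordinatewise estimates back to the Euclidean ball: N (delta / (N + 1))^2 < delta^2,
    as N < (N + 1)^2. *)
Lemma coord_eball (R : realType) (N : nat) (x y : 'rV[R]_N) (delta : R) :
  0 < delta -> (forall i, `|y ord0 i - x ord0 i| < delta / N.+1%:R) ->
  eball x delta y.
Proof.
move=> d0 H; rewrite /eball /= enorm_ltE//.
have k0 : 0 < N.+1%:R :> R by [].
apply: (@le_lt_trans _ _ (\sum_(i < N) (delta / N.+1%:R) ^+ 2)).
  apply: ler_sum => i _; rewrite -expr2 !mxE -[leLHS]real_normK ?num_real//.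
  by rewrite lerXn2r ?nnegrE ?divr_ge0 ?(ltW d0)// ltW.
rewrite sumr_const card_ord -[X in X < _]mulr_natl.
have -> : N%:R * (delta / N.+1%:R) ^+ 2 = delta ^+ 2 * (N%:R / N.+1%:R ^+ 2).
  by field; rewrite gt_eqF.
rewrite gtr_pMr ?exprn_gt0// ltr_pdivrMr ?exprn_gt0// mul1r -natrX ltr_nat.
by rewrite (leq_trans (ltnSn N))// leq_pmulr.
Qed.

(** The deterministic estimate is applied path by path, on the almost sure set where both paths are
    continuous, B starts at 0 and the equation holds. The constants K and h0 depend on delta and e
    but not on h, while the event E does depend on h. *)
Lemma good_event (R : realType) (N : nat)
  (Gamma : set R[i]) (l : R) (gamma : R -> R[i])
  (Hgamma : jordan_arclength Gamma l gamma) (beta c : R) (c_gt0 : 0 < c)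
  (d : measure_display) (Omega : measurableType d) (P : probability Omega R)
  (B : R -> Omega -> 'rV[R]_N) (HB : brownian_motion P B)
  (x : 'rV[R]_N) (X : R -> Omega -> 'rV[R]_N) (Dx : chamber l x)
  (HX : strong_solution P (chamber l) (drift c beta gamma) B x X)
  (delta e : R) : 0 < delta -> 0 < e ->
  exists K h0 : R, [/\ 0 <= K, 0 < h0 & forall h : R, 0 < h < h0 ->
    exists E : set Omega, [/\ measurable E, (P E <= (K * h ^+ 2)%:E)%E &
      {ae P, forall w, ~ E w -> eball x delta (X h w) /\
        forall i, `|X h w ord0 i - x ord0 i - (B h w - B 0 w) ord0 i -
          h * drift c beta gamma x ord0 i| <= h * e}]].
Proof.
move=> d0 e0.
have [r1 r10 near1] :=
  @drift_near R Gamma l gamma Hgamma N c beta e x c_gt0 e0 Dx.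
pose b : 'rV[R]_N -> 'rV[R]_N := drift c beta gamma.
(* Two demands on the cube: the drift varies by at most e on it, and it lies in the ball of radius
   delta. *)
pose r : R := Num.min r1 (delta / N.+1%:R).
have r0 : 0 < r by rewrite lt_min r10 divr_gt0.
pose M := \sum_i `|b x ord0 i| + e.
have M0 : 0 < M by rewrite ltr_wpDl// sumr_ge0.
have bM i : `|b x ord0 i| + e <= M.
  by rewrite lerD2r (bigD1 i)//= lerDl sumr_ge0.
have r20 : 0 < r / 2 by rewrite divr_gt0.
have [K K0 HK] := brownian_small_increments HB r20.
exists K, (r / 2 / M); split; rewrite ?divr_gt0// => h /andP[h0 hM].
have [E [mE PE Esmall]] := HK h h0.
exists E; split => //.
have [_ _ Xc _ Xi Xe] := HX.
have [_ B0 Bc _ _] := HB.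
near=> w => nE.
have Xcw : {within `[0, +oo[%classic, continuous (fun t => X t w)} by near: w.
have Bcw : {within `[0, +oo[%classic, continuous (fun t => B t w)} by near: w.
have B0w : B 0 w = 0 by near: w.
have Xiw : forall t, 0 <= t -> forall i : 'I_N, lebesgue_measure.-integrable
  `[0, t] (fun s => (b (X s w) ord0 i)%:E) by near: w.
have Xew : forall t, 0 <= t -> X t w = x + B t w + \row_(i < N)
  \int[lebesgue_measure]_(s in `[0, t]) b (X s w) ord0 i by near: w.
have rnear (y : 'rV[R]_N) : (forall i, `|y ord0 i - x ord0 i| < r) ->
    forall i, `|b y ord0 i - b x ord0 i| <= e.
  move=> yr; apply: near1 => i; apply: (lt_le_trans (yr i)).
  by rewrite ge_min lexx.
have Bs (t : R) : 0 <= t <= h -> forall i, `|B t w ord0 i| <= r / 2.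
  move=> th i.
  have := @small_dyadic_increments_sup R (r / 2) h (fun t => B t w ord0 i).
  apply => //; first exact: ltW.
  - by rewrite B0w mxE.
  - move=> s s0 k k0; have [m m0 mP] := continuous_path_coord Bcw s0 k0.
    by exists m => // u u0 us; exact: mP.
  - exact: Esmall.
have hM' : h * M < r / 2 by rewrite -ltr_pdivlMr.
have Xcoord := continuous_path_coord Xcw.
have hh : 0 <= h <= h by rewrite lexx ltW.
split.
  apply: coord_eball => // i.
  apply: (@lt_le_trans _ _ r); last by rewrite ge_min lexx orbT.
  exact: (path_in_ball (ltW e0) rnear bM hM' Xcoord Xiw Xew Bs r0 hh).
move=> i; rewrite B0w subr0.
exact: (path_increment (ltW e0) rnear bM (ltW h0) hM' Xcoord Xiw Xew Bs r0).
Unshelve. all: by end_near. Qed.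

(** * The three limits *)

Section probability_integrals.
Context d (T : measurableType d) (R : realType) (P : probability T R).
Implicit Types (f g : T -> R) (k : R) (E : set T).

Lemma integrable_addf f g : P.-integrable setT (EFin \o f) ->
  P.-integrable setT (EFin \o g) ->
  P.-integrable setT (EFin \o (fun w => f w + g w)).
Proof. by move=> hf hg; exact: (integrableD measurableT hf hg). Qed.

Lemma integrable_subf f g : P.-integrable setT (EFin \o f) ->
  P.-integrable setT (EFin \o g) ->
  P.-integrable setT (EFin \o (fun w => f w - g w)).
Proof. by move=> hf hg; exact: (integrableB measurableT hf hg). Qed.

Lemma integrable_mulfl k f : P.-integrable setT (EFin \o f) ->
  P.-integrable setT (EFin \o (fun w => k * f w)).
Proof. by move=> hf; exact: (integrableZl measurableT k hf). Qed.

Lemma integrable_cstf k : P.-integrable setT (EFin \o (fun=> k)).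
Proof. exact: finite_measure_integrable_cst. Qed.

Lemma Rintegral_indic_le E k : measurable E -> (P E <= k%:E)%E ->
  P.-integrable setT (EFin \o \1_E) /\ \int[P]_w \1_E w <= k.
Proof.
move=> mE PE; have iE : P.-integrable setT (EFin \o \1_E).
  exact: integrable_indic.
split => //.
rewrite -lee_fin /Rintegral fineK; last exact: integrable_fin_num iE.
by rewrite integral_indic// setIT.
Qed.

End probability_integrals.

(** Cauchy-Schwarz against the constant vector, by u_i u_j <= (u_i^2 + u_j^2) / 2 in the double
    sum. *)
Lemma sqr_sum_le (R : realType) (N : nat) (u : 'I_N -> R) :
  (\sum_i u i) ^+ 2 <= N%:R * \sum_i u i ^+ 2.
Proof.
have -> : N%:R * \sum_i u i ^+ 2 = \sum_i \sum_j (u i ^+ 2 + u j ^+ 2) / 2.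
  transitivity (\sum_(i < N) (N%:R * u i ^+ 2 + \sum_j u j ^+ 2) / 2).
    rewrite -mulr_suml big_split/= -mulr_sumr sumr_const card_ord.
    by rewrite -[X in _ + X]mulr_natl; field.
  apply: eq_bigr => i _; rewrite -mulr_suml big_split/= sumr_const card_ord.
  by rewrite mulr_natl.
rewrite expr2 mulr_suml; apply: ler_sum => i _.
rewrite mulr_sumr; apply: ler_sum => j _.
have := sqr_ge0 (u i - u j); nra.
Qed.

Section kolmogorov.
Context (R : realType) (N : nat).
Variables (Gamma : set R[i]) (l : R) (gamma : R -> R[i]).
Hypothesis Hgamma : jordan_arclength Gamma l gamma.
Variables (beta c : R).
Hypothesis c_gt0 : 0 < c.
Context (d : measure_display) (Omega : measurableType d).
Variables (P : probability Omega R) (B : R -> Omega -> 'rV[R]_N).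
Hypothesis HB : brownian_motion P B.
Variable X : 'rV[R]_N -> R -> Omega -> 'rV[R]_N.
Hypothesis HX : forall x, chamber l x ->
  strong_solution P (chamber l) (drift c beta gamma) B x (X x).
Variable p : 'rV[R]_N -> R -> 'rV[R]_N -> R.
Hypothesis Hp : transition_density P (chamber l) X p.
Variables (delta : R) (x : 'rV[R]_N).
Hypotheses (delta_gt0 : 0 < delta) (Dx : chamber l x).
Hypothesis ball_sub : eball x delta `<=` chamber l.

Let b i := drift c beta gamma x ord0 i.
Let W h w : 'rV[R]_N := B h w - B 0 w.
Let A := eball x delta.

Let mA : measurable A. Proof. exact: measurable_eball. Qed.

Let mX h : 0 < h -> measurable_fun setT (X x h).
Proof. by move=> h0; apply: (sol_measurable (HX Dx)); exact: ltW. Qed.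

(** Off E the process at time h is in the ball, so the exit indicator is almost surely at most that
    of E, whose probability is of order h^2. *)
Lemma exit_probability_limit :
  h^-1 * \int[lebesgue_rV N]_(y in chamber l `\` A) p x h y
    @[h --> 0^'+] --> (0 : R).
Proof.
apply: rescaled_limit => e e0.
have [K [h0 [K0 h00 HE]]] := good_event Hgamma c_gt0 HB Dx (HX Dx) delta_gt0 e0.
exists K, h0; split => // h hh; have [E [mE PE goodE]] := HE h hh.
have hgt : 0 < h by case/andP: hh.
have mDA : measurable (chamber l `\` A : set 'rV[R]_N).
  by apply: measurableD => //; exact: measurable_chamber.
have -> : \int[lebesgue_rV N]_(y in chamber l `\` A) p x h y =
    \int[lebesgue_rV N]_(y in chamber l `\` A) (cst 1 y * p x h y).
  by apply: eq_Rintegral => y _; rewrite mul1r.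
have sub : chamber l `\` A `<=` chamber l by move=> y [].
have le1 y : (chamber l `\` A) y -> `|cst 1 y : R| <= 1 by rewrite normr1.
have m1 : measurable_fun setT (cst 1 : 'rV[R]_N -> R) by [].
rewrite (Rintegral_transition_density Hp Dx hgt (mX hgt) mDA sub m1 le1).
have iU := integrable_indic_transition P (mX hgt) mDA m1 le1.
have [iE PE'] := Rintegral_indic_le mE PE.
rewrite mulr0 subr0.
apply: (@le_trans _ _ (\int[P]_w \1_E w)); last first.
  by apply: le_trans PE' _; rewrite lerDr mulr_ge0 ?ltW.
apply: normr_Rintegral_le_ae => //.
apply: filterS goodE => w; rewrite !indicE; have [wE _|wE] := boolP (w \in E).
  by case: (_ \in _); rewrite ?mul1r ?mul0r ?normr1 ?normr0.
move=> [|XA _]; first by move=> Ew; rewrite mem_set in wE.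
rewrite memNset ?mul0r ?normr0//; by move=> [].
Qed.

(** Since W has mean zero, it can be subtracted from the truncated displacement without changing the
    integral. Off E what remains after subtracting h b as well is at most h e; on E each of the
    three terms is bounded separately. *)
Lemma drift_limit i :
  h^-1 * \int[lebesgue_rV N]_(y in A) ((y - x) ord0 i * p x h y)
    @[h --> 0^'+] --> b i.
Proof.
apply: rescaled_limit => e e0.
have [K [h0 [K0 h00 HE]]] := good_event Hgamma c_gt0 HB Dx (HX Dx) delta_gt0 e0.
(* The cost on E: delta for the truncated displacement, 1 from |W| <= 1 + W^4, and |b| for the drift
   term, using h < 1. The extra 32 below is the fourth moment. *)
pose C := delta + 1 + `|b i|.
have C0 : 0 <= C by rewrite !addr_ge0// ltW.
exists (C * K + 32), (Num.min h0 1); split.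
- by rewrite addr_ge0// mulr_ge0.
- by rewrite lt_min h00/=.
move=> h /andP[hgt]; rewrite lt_min => /andP[hh0 h1].
have [|E [mE PE goodE]] := HE h; first by rewrite hgt.
pose f (y : 'rV[R]_N) := (y - x) ord0 i.
have mf : measurable_fun setT f.
  rewrite /f; under eq_fun do rewrite !mxE.
  by apply: measurable_funB => //; exact: measurable_coord.
have fM y : A y -> `|f y| <= delta.
  by move=> Ay; rewrite /f !mxE ltW// eball_coord.
rewrite (Rintegral_transition_density Hp Dx hgt (mX hgt) mA ball_sub mf fM).
have iU := integrable_indic_transition P (mX hgt) mA mf fM.
have [iE PE'] := Rintegral_indic_le mE PE.
have [iW EW] := brownian_increment_mean HB hgt i.
have [iW4 EW4] := brownian_increment_fourth HB hgt i.
pose U w := \1_A (X x h w) * f (X x h w) - W h w ord0 i - h * b i.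
pose V w := h * e + C * \1_E w + W h w ord0 i ^+ 4.
have iU1 := integrable_subf iU iW.
have iUU : P.-integrable setT (EFin \o U).
  by apply: integrable_subf => //; exact: integrable_cstf.
have iV1 : P.-integrable setT (EFin \o (fun w => h * e + C * \1_E w)).
  by apply: integrable_addf; [exact: integrable_cstf|exact: integrable_mulfl].
have iV : P.-integrable setT (EFin \o V) by exact: integrable_addf.
have -> : \int[P]_w (\1_A (X x h w) * f (X x h w)) - h * b i = \int[P]_w U w.
  rewrite /U RintegralB//; last exact: integrable_cstf.
  by rewrite RintegralB// EW subr0 Rintegral_cst_probability.
have W4 w : 0 <= W h w ord0 i ^+ 4 by rewrite (exprM _ 2 2) sqr_ge0.
apply: (@le_trans _ _ (\int[P]_w V w)); last first.
  rewrite /V RintegralD// RintegralD//; last 2 first.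
  - exact: integrable_cstf.
  - exact: integrable_mulfl.
  rewrite Rintegral_cst_probability RintegralZl//.
  by have := ler_wpM2l C0 PE'; lra.
apply: normr_Rintegral_le_ae => //.
  by move=> w; rewrite !addr_ge0// mulr_ge0// ltW.
apply: filterS goodE => w; rewrite /U /V.
have [wE _|wE] := boolP (w \in E); last first.
  have E0 : \1_E w = 0 :> R by rewrite indicE (negbTE wE).
  move=> [|XA /(_ i) H]; first by move=> Ew; rewrite mem_set in wE.
  have fE : f (X x h w) = X x h w ord0 i - x ord0 i by rewrite /f !mxE.
  rewrite E0 indicE mem_set// mul1r mulr0 addr0 fE.
  by apply: le_trans H _; rewrite lerDl.
have fd : `|\1_A (X x h w) * f (X x h w)| <= delta.
  rewrite indicE; case: (boolP (X x h w \in A)) => XA.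
    by rewrite mul1r fM// -inE.
  by rewrite mul0r normr0 ltW.
have -> : \1_E w = 1 :> R by rewrite indicE wE.
rewrite mulr1.
apply: le_trans (ler_normB _ _) _.
apply: le_trans (lerD (ler_normB _ _) (lexx _)) _.
rewrite (normrM h) gtr0_norm//.
have hb : h * `|b i| <= `|b i| by rewrite ler_piMl// ltW.
have he : 0 <= h * e by rewrite mulr_ge0 ?ltW.
have W1 : `|W h w ord0 i| <= 1 + W h w ord0 i ^+ 4.
  rewrite -[W h w ord0 i ^+ 4]ger0_norm// normrX.
  have := normr_ge0 (W h w ord0 i); set u := `|_| => u0.
  have := sqr_ge0 (u ^+ 2 - 2^-1); have := sqr_ge0 (u - 2^-1).
  rewrite (exprM u 2 2); nra.
have aux (u v w4 hb' bb k : R) : u <= delta -> v <= 1 + w4 -> hb' <= bb ->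
    0 <= k -> u + v + hb' <= k + (delta + 1 + bb) + w4 by lra.
exact: aux.
Qed.

(** The square of W.z has mean exactly h |z|^2, so it is the term to compare with. Off E, X(h) - x
    differs from W by order h, so a drift tolerance of 1 is enough; the cross term is split by a
    weighted Young inequality. *)
Lemma diffusion_limit (z : 'rV[R]_N) :
  h^-1 * \int[lebesgue_rV N]_(y in A) (dotp (y - x) z ^+ 2 * p x h y)
    @[h --> 0^'+] --> dotp z z.
Proof.
apply: rescaled_limit => e e0.
have [K [h0 [K0 h00 HE]]] :=
  good_event Hgamma c_gt0 HB Dx (HX Dx) delta_gt0 ltr01.
have zz0 : 0 <= dotp z z by apply: sumr_ge0 => i _; rewrite -expr2 sqr_ge0.
(* The Young weight: eta times the mean h |z|^2 is at most h e. *)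
pose eta := e / (dotp z z + 1).
have eta0 : 0 < eta by rewrite divr_gt0// ltr_wpDl.
have etaE : eta * dotp z z <= e.
  by rewrite /eta mulrAC ler_pdivrMr ?ltr_wpDl// ler_pM2l// lerDl.
(* h C1 bounds |(X(h) - x - W).z| off E, the summand 1 being the tolerance; C2 bounds |(y - x).z| on
   the ball; C3 is the constant left when W_i^2 <= 1 + W_i^4 is inserted in the Cauchy-Schwarz bound
   of (W.z)^2; C4 makes the slack in Young's inequality a perfect square. *)
pose C1 := \sum_i `|z ord0 i| * (`|b i| + 1).
pose C2 := delta * \sum_i `|z ord0 i|.
pose C3 := N%:R * \sum_i z ord0 i ^+ 2.
pose C4 := C1 ^+ 2 / eta + C1 ^+ 2.
have C10 : 0 <= C1 by apply: sumr_ge0 => i _; rewrite mulr_ge0// addr_ge0.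
have C20 : 0 <= C2 by rewrite mulr_ge0 ?(ltW delta_gt0)// sumr_ge0.
have C30 : 0 <= C3 by rewrite mulr_ge0// sumr_ge0// => i _; rewrite sqr_ge0.
have C40 : 0 <= C4 by rewrite addr_ge0 ?sqr_ge0// divr_ge0 ?sqr_ge0// ltW.
have C23 : 0 <= C2 ^+ 2 + C3 by rewrite addr_ge0// sqr_ge0.
exists (C4 + (C2 ^+ 2 + C3) * K + 32 * C3), h0; split => //.
  by apply: addr_ge0; [apply: addr_ge0 => //|]; exact: mulr_ge0.
move=> h hh; have [E [mE PE goodE]] := HE h hh.
have hgt : 0 < h by case/andP: hh.
pose f (y : 'rV[R]_N) := dotp (y - x) z ^+ 2.
have mf : measurable_fun setT f.
  by apply: measurable_funX; exact: measurable_dotpB.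
have fM y : A y -> `|f y| <= C2 ^+ 2.
  move=> Ay; rewrite /f normrX lerXn2r ?nnegrE//.
  rewrite /dotp /C2 mulr_sumr; apply: le_trans (ler_norm_sum _ _ _) _.
  apply: ler_sum => i _; rewrite normrM ler_wpM2r// !mxE ltW//.
  exact: eball_coord.
rewrite (Rintegral_transition_density Hp Dx hgt (mX hgt) mA ball_sub mf fM).
have iU := integrable_indic_transition P (mX hgt) mA mf fM.
have [iE PE'] := Rintegral_indic_le mE PE.
have [iW2 EW2] := brownian_increment_dotp_sqr z HB hgt.
pose S4 w := \sum_i N%:R * z ord0 i ^+ 2 * W h w ord0 i ^+ 4.
have iS4i i : P.-integrable setT
    (EFin \o (fun w => N%:R * z ord0 i ^+ 2 * W h w ord0 i ^+ 4)).
  apply: integrable_mulfl; exact: (brownian_increment_fourth HB hgt i).1.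
have [iS4 ES4] := Rintegral_sum (index_enum 'I_N) iS4i.
have S4le : \int[P]_w S4 w <= 32 * C3 * h ^+ 2.
  rewrite /S4 ES4 /C3 mulrA mulrC mulrA mulrA mulr_sumr; apply: ler_sum => i _.
  have [iW4 EW4] := brownian_increment_fourth HB hgt i.
  rewrite RintegralZl//.
  rewrite (_ : h ^+ 2 * 32 * N%:R * z ord0 i ^+ 2 =
    N%:R * z ord0 i ^+ 2 * (32 * h ^+ 2)); last by ring.
  by rewrite ler_wpM2l// mulr_ge0// sqr_ge0.
pose U w := \1_A (X x h w) * f (X x h w) - dotp (W h w) z ^+ 2.
pose V w := eta * dotp (W h w) z ^+ 2 + C4 * h ^+ 2 +
  (C2 ^+ 2 + C3) * \1_E w + S4 w.
have iUU : P.-integrable setT (EFin \o U) by exact: integrable_subf.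
have iV1 := integrable_mulfl eta iW2.
have iV2 := integrable_addf iV1 (integrable_cstf P (C4 * h ^+ 2)).
have iV3 := integrable_addf iV2 (integrable_mulfl (C2 ^+ 2 + C3) iE).
have iV : P.-integrable setT (EFin \o V) by exact: integrable_addf.
have -> : \int[P]_w (\1_A (X x h w) * f (X x h w)) - h * dotp z z =
    \int[P]_w U w.
  by rewrite /U RintegralB// EW2.
have S40 w : 0 <= S4 w.
  apply: sumr_ge0 => i _; rewrite (exprM _ 2 2).
  by apply: mulr_ge0; [apply: mulr_ge0|]; rewrite ?sqr_ge0.
apply: (@le_trans _ _ (\int[P]_w V w)); last first.
  rewrite /V RintegralD// RintegralD//; last exact: integrable_mulfl.
  rewrite RintegralD//; last exact: integrable_cstf.
  rewrite RintegralZl// RintegralZl// Rintegral_cst_probability EW2.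
  have := ler_wpM2l C23 PE'.
  have : eta * (h * dotp z z) <= h * e by rewrite mulrCA ler_wpM2l// ltW.
  move: S4le.
  set s4 := \int[P]_w S4 w; set ie := \int[P]_w \1_E w; lra.
apply: normr_Rintegral_le_ae => //.
  move=> w; apply: addr_ge0 => //; apply: addr_ge0; last exact: mulr_ge0.
  by apply: addr_ge0; apply: mulr_ge0; rewrite ?sqr_ge0// ltW.
apply: filterS goodE => w; rewrite /U /V.
have w4 i : W h w ord0 i ^+ 2 <= 1 + W h w ord0 i ^+ 4.
  by rewrite (exprM _ 2 2); have := sqr_ge0 (W h w ord0 i ^+ 2 - 2^-1); nra.
have w2le : dotp (W h w) z ^+ 2 <= C3 + S4 w.
  apply: le_trans (sqr_sum_le _) _.
  rewrite /C3 /S4 !mulr_sumr -big_split/=; apply: ler_sum => i _.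
  have := ler_wpM2l (sqr_ge0 (z ord0 i)) (w4 i).
  have N0 : 0 <= N%:R :> R by [].
  move=> /(ler_wpM2l N0); rewrite exprMn; lra.
have fd : 0 <= \1_A (X x h w) * f (X x h w) <= C2 ^+ 2.
  rewrite indicE; case: (boolP (X x h w \in A)) => XA.
    by rewrite mul1r sqr_ge0/= (le_trans (ler_norm _))// fM// -inE.
  by rewrite mul0r lexx sqr_ge0.
have w20 : 0 <= eta * dotp (W h w) z ^+ 2 by rewrite mulr_ge0 ?sqr_ge0// ltW.
have c40 : 0 <= C4 * h ^+ 2 by rewrite mulr_ge0 ?sqr_ge0.
have [wE _|wE] := boolP (w \in E); last first.
  have E0 : \1_E w = 0 :> R by rewrite indicE (negbTE wE).
  move=> [|XA H]; first by move=> Ew; rewrite mem_set in wE.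
  rewrite E0 indicE mem_set// mul1r mulr0 addr0 /f.
  set v := dotp (W h w) z in w2le w20 *; set y := dotp _ z.
  have yv : `|y - v| <= h * C1.
    rewrite /y /v /dotp -sumrB /C1 mulr_sumr.
    apply: le_trans (ler_norm_sum _ _ _) _; apply: ler_sum => i _.
    rewrite -mulrBl normrM mulrC mulrCA ler_wpM2l//.
    have -> : (X x h w - x) ord0 i = X x h w ord0 i - x ord0 i by rewrite !mxE.
    have := H i; rewrite -/(b i) mulr1 => Hi.
    rewrite mulrDr mulr1.
    rewrite -[X in X + h](ger0_norm (mulr_ge0 (ltW hgt) (normr_ge0 _))).
    set u := (X in `|X|); rewrite -(subrK (h * b i) u).
    apply: le_trans (ler_normD _ _) _; rewrite addrC lerD//.
    by rewrite normrM normrM normr_id.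
  have yvE : y ^+ 2 - v ^+ 2 = (y - v) * (2 * v + (y - v)) by ring.
  have : `|y ^+ 2 - v ^+ 2| <= eta * v ^+ 2 + C4 * h ^+ 2.
    rewrite yvE normrM.
    apply: (@le_trans _ _ (h * C1 * (2 * `|v| + h * C1))).
      apply: ler_pM => //; apply: le_trans (ler_normD _ _) _.
      by rewrite normrM ger0_norm// lerD.
    have -> : eta * v ^+ 2 = eta * `|v| ^+ 2 by rewrite real_normK ?num_real.
    (* Completing the square in |v|. *)
    rewrite -subr_ge0.
    have -> : eta * `|v| ^+ 2 + C4 * h ^+ 2 - h * C1 * (2 * `|v| + h * C1) =
        eta * (`|v| - h * C1 / eta) ^+ 2.
      by rewrite /C4; field; rewrite gt_eqF.
    by rewrite mulr_ge0 ?sqr_ge0// ltW.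
  by move/le_trans; apply; rewrite lerDl.
have -> : \1_E w = 1 :> R by rewrite indicE wE.
rewrite mulr1.
have aux (u v a1 a2 c2 c3 s4 : R) : 0 <= u <= c2 -> 0 <= v -> v <= c3 + s4 ->
    0 <= a1 -> 0 <= a2 -> 0 <= c2 -> `|u - v| <= a1 + a2 + (c2 + c3) + s4.
  by move=> /andP[? ?] ? ? ? ? ?; rewrite ler_norml; apply/andP; split; lra.
by apply: aux => //; exact: sqr_ge0.
Qed.

End kolmogorov.

Lemma cvg_rV (R : realType) (N : nat) (T : Type) (F : set_system T)
    (f : T -> 'rV[R]_N) (L : 'rV[R]_N) : Filter F ->
  (forall i, f t ord0 i @[t --> F] --> L ord0 i) -> f @ F --> L.
Proof.
move=> FF fL; apply/cvg_ballP => e e0.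
have : \forall t \near F, forall i, ball (L ord0 i) e (f t ord0 i).
  apply: (@filter_forall _ _ _ _ FF) => i.
  by have /cvg_ballP := fL i; apply.
by apply: filterS => t ft; split => // i j; rewrite (ord1 i); exact: ft.
Qed.

Unset Implicit Arguments.
Set Strict Implicit.

Theorem proposition3p9 (R : realType) (N : nat) (N_gt0 : (0 < N)%N)
  (Gamma : set R[i]) (l : R) (gamma : R -> R[i])
  (Hgamma : jordan_arclength Gamma l gamma)
  (beta c : R) (beta_ge1 : 1 <= beta) (c_gt0 : 0 < c)
  (d : measure_display) (Omega : measurableType d) (P : probability Omega R)
  (B : R -> Omega -> 'rV[R]_N) (HB : brownian_motion P B)
  (X : 'rV[R]_N -> R -> Omega -> 'rV[R]_N)
  (HX : forall x, chamber l x ->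
     strong_solution P (chamber l) (drift c beta gamma) B x (X x))
  (p : 'rV[R]_N -> R -> 'rV[R]_N -> R)
  (Hp : transition_density P (chamber l) X p) :
  forall (delta : R) (x z : 'rV[R]_N), 0 < delta -> chamber l x ->
    closure (eball x delta) `<=` chamber l ->
    [/\ h^-1 * \int[lebesgue_rV N]_(y in chamber l `\` eball x delta) p x h y
          @[h --> 0^'+] --> (0 : R),
        h^-1 *: (\row_(i < N) \int[lebesgue_rV N]_(y in eball x delta)
                   ((y - x) ord0 i * p x h y))
          @[h --> 0^'+] --> drift c beta gamma x
      & h^-1 * \int[lebesgue_rV N]_(y in eball x delta)
                   ((dotp (y - x) z) ^+ 2 * p x h y)
          @[h --> 0^'+] --> (enorm z ^+ 2)].
Proof.
move=> delta x z delta0 Dx subD.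
have bsub : eball x delta `<=` chamber l.
  exact: subset_trans (@subset_closure _ _) subD.
split.
- exact: (exit_probability_limit Hgamma c_gt0 HB HX Hp delta0 Dx).
- apply: cvg_rV => i.
  have := drift_limit Hgamma c_gt0 HB HX Hp delta0 Dx bsub (i := i).
  by apply: cvg_trans; apply: near_eq_cvg; apply: nearW => h; rewrite !mxE.
- rewrite sqr_sqrtr; last by apply: sumr_ge0 => i _; rewrite -expr2 sqr_ge0.
  exact: (diffusion_limit Hgamma c_gt0 HB HX Hp delta0 Dx bsub).
Qed.
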